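(* Let $k\ge 1$, let $w\in\mathbf{F}_k$ be a non-trivial word and let $\varepsilon>0$. There exists an integer $N(\varepsilon,w)$ (depending only on $\varepsilon$ and $w$) such that the following holds. Let $G$ be one of the groups $\mathrm{GL}_n(q)$, $\mathrm{Sp}_{2n'}(q)$, $\mathrm{GO}_{2n'+1}(q)$, $\mathrm{GO}^{\pm}_{2n'}(q)$, or $\mathrm{GU}_n(q)$, where $q$ is a prime power, $n\ge2$, $n'\ge1$. If the degree $n(G)$ satisfies $n(G)\geq N(\varepsilon,w)$, then the word image $w(G)$ is $\varepsilon$-dense in $G$ with respect to the normalized rank metric $d_{\mathrm{rk}}$.
   Context: $\mathbf{F}_k$ is the free group freely generated by $x_1,\dots,x_k$. For a group $G$, $w(g_1,\dots,g_k)$ is the image of $w$ under the homomorphism $\mathbf{F}_k\to G$ with $x_i\mapsto g_i$, and $w(G)=\{w(g_1,\dots,g_k)\mid g_1,\dots,g_k\in G\}\subseteq G$ is the word image. $\mathrm{GL}_n(q)$ is the general linear group over $\mathbb{F}_q$; $\mathrm{Sp}_{2n'}(q)$ is the isometry group of a non-singular alternating bilinear form on $\mathbb{F}_q^{2n'}$; $\mathrm{GO}_{2n'+1}(q)$ and $\mathrm{GO}^\pm_{2n'}(q)$ are the full isometry groups of non-singular quadratic forms on $\mathbb{F}_q^{2n'+1}$ resp. $\mathbb{F}_q^{2n'}$ (of $+$ or $-$ type); $\mathrm{GU}_n(q)$ is the isometry group of a non-singular conjugate-symmetric sesquilinear form on $\mathbb{F}_{q^2}^n$ (conjugation being $x\mapsto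 x^q$). The degree $n(G)$ is the dimension of the natural module of $G$ (that is, $n$, $2n'$, $2n'+1$, $2n'$, $n$ respectively). The normalized rank metric is $d_{\mathrm{rk}}(g,h)=\mathrm{rk}(g-h)/n(G)$ for $g,h\in G$, where the rank is taken of the linear map $g-h$ on the natural module. A subset $Y$ of a metric space $(X,d)$ is $\varepsilon$-dense in $X$ if $d(x,Y)=\inf_{y\in Y}d(x,y)\le\varepsilon$ for all $x\in X$. *)

(* Defs.v *)
From HB Require Import structures.
From mathcomp Require Import all_boot all_order all_algebra all_fingroup.
From mathcomp Require Import classical_sets reals.

Set Implicit Arguments.
Unset Strict Implicit.
Unset Printing Implicit Defensive.

Import Order.TTheory GRing.Theory Num.Theory.

(* The free group on T is the set of reduced words in the letters             *)
(* (x, false) = x and (x, true) = x^-1, multiplied by concatenating and       *)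
(* cancelling; free_group_universal below is its universal property.          *)
Section FreeGroup.
Variable T : choiceType.
Implicit Types (a b : T * bool) (s t u : seq (T * bool)).

Definition flip a := (a.1, ~~ a.2).

Definition reduced s := sorted [rel a b | b != flip a] s.

Definition push a s :=
  if s is b :: s' then if b == flip a then s' else a :: s else [:: a].

Lemma flipK : involutive flip.
Proof. by case=> x b; rewrite /flip /= negbK. Qed.

Lemma reduced_push a s : reduced s -> reduced (push a s).
Proof.
case: s => [|b s] //= bs; case: (eqVneq b (flip a)) => [_|ba] /=.
  exact: path_sorted bs.
by rewrite /reduced /= ba.
Qed.

Lemma push_flip a s : reduced s -> push a (push (flip a) s) = s.
Proof.
case: s => [|b s] /=; first by rewrite eqxx.
rewrite flipK /reduced /=; case: (eqVneq b a) => [->|_] /=; last by rewrite eqxx.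
by case: s => [|c s] //= /andP[/negPf-> _].
Qed.

Lemma reduced_foldr s t : reduced t -> reduced (foldr push t s).
Proof. by move=> tr; elim: s => //= a s; apply: reduced_push. Qed.

Lemma foldr_push a s u : reduced u ->
  foldr push u (push a s) = push a (foldr push u s).
Proof.
move=> ur; case: s => [|b s] //=; case: eqP => [->|//].
by rewrite push_flip //; apply: reduced_foldr.
Qed.

Lemma reduced_foldr1 s : reduced s -> foldr push [::] s = s.
Proof.
elim: s => //= a s IH sr; rewrite IH; last exact: path_sorted sr.
by case: s sr {IH} => //= b s /andP[/negPf->].
Qed.

Lemma reduced_inv s : reduced s -> reduced (rev (map flip s)).
Proof.
rewrite /reduced rev_sorted; case: s => //= a s.
rewrite path_map; apply: sub_path => b c /=; apply: contraNneq.
by move=> /(can_inj flipK)->; rewrite flipK.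
Qed.

Lemma foldr_inv s : reduced s -> foldr push s (rev (map flip s)) = [::].
Proof.
elim: s => //= a s IH sr; rewrite rev_cons foldr_rcons /= flipK eqxx.
by rewrite IH //; apply: path_sorted sr.
Qed.

Record free_group := FreeGroup { word :> seq (T * bool); _ : reduced word }.
HB.instance Definition _ := [isSub for word].
HB.instance Definition _ := [Choice of free_group by <:].
Implicit Types v w : free_group.

Definition free_one := @FreeGroup [::] isT.
Definition free_mul v w := FreeGroup (reduced_foldr v (valP w)).
Definition free_inv w := FreeGroup (reduced_inv (valP w)).

Lemma free_mulA : associative free_mul.
Proof.
move=> u v w; apply: val_inj => /=; case: u => u _ /=.
elim: u => //= a u ->; rewrite foldr_push //; exact: valP.
Qed.

Lemma free_mul1 : left_id free_one free_mul.
Proof. by move=> w; apply: val_inj. Qed.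

Lemma free_mulr1 : right_id free_one free_mul.
Proof. by move=> w; apply: val_inj; apply: reduced_foldr1 (valP w). Qed.

Lemma free_mulV : left_inverse free_one free_inv free_mul.
Proof. by move=> w; apply: val_inj; apply: foldr_inv (valP w). Qed.

Lemma free_invK : involutive free_inv.
Proof.
move=> w; apply: val_inj => /=.
by rewrite map_rev revK (mapK flipK).
Qed.

Lemma free_mulrV : right_inverse free_one free_inv free_mul.
Proof. by move=> w; rewrite -{1}[w]free_invK free_mulV. Qed.

HB.instance Definition _ :=
  isGroup.Build free_group free_mulA free_mul1 free_mulr1 free_mulV free_mulrV.

Definition free_gen (x : T) := @FreeGroup [:: (x, false)] isT.

End FreeGroup.

Section WordEvaluation.
Local Open Scope group_scope.
Variables (T : choiceType) (gT : groupType) (g : T -> gT).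

Definition letter_eval (a : T * bool) : gT := if a.2 then (g a.1)^-1 else g a.1.

Definition word_eval (w : free_group T) : gT :=
  \big[*%g/1]_(a <- word w) letter_eval a.

Lemma word_eval_push a s :
  \big[*%g/1]_(b <- push a s) letter_eval b =
  letter_eval a * \big[*%g/1]_(b <- s) letter_eval b.
Proof.
case: s => [|b s] /=; first by rewrite big_cons.
case: eqP => [->|_]; last by rewrite big_cons.
rewrite big_cons mulgA; case: a => x [] /=; rewrite /letter_eval /=.
  by rewrite mulVg mul1g.
by rewrite mulgV mul1g.
Qed.

Lemma word_eval_morphism : monoid.monoid_morphism word_eval.
Proof.
split=> [|v w]; first exact: big_nil.
rewrite /word_eval /=; elim: (word v) => [|a s IH] /=.
  by rewrite big_nil mul1g.
by rewrite word_eval_push IH big_cons mulgA.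
Qed.

HB.instance Definition _ :=
  isUMagmaMorphism.Build (free_group T) gT word_eval word_eval_morphism.

Lemma word_eval_gen x : word_eval (free_gen x) = g x.
Proof. exact: big_seq1. Qed.

End WordEvaluation.

Lemma free_group_universal (T : choiceType) (gT : groupType) (g : T -> gT)
    (f : free_group T -> gT) :
  monoid.monoid_morphism f -> (forall x, f (free_gen x) = g x) -> f =1 word_eval g.
Proof.
move=> [f1 fM] fg [s sr]; rewrite /word_eval /=.
have fV x : f (@FreeGroup T [:: (x, true)] isT) = ((g x)^-1)%g.
  apply: (mulIg (g x)); rewrite mulVg -fg -fM -f1; congr f.
  by apply: val_inj => /=; rewrite eqxx.
elim: s sr => [|a s IH] sr.
  by rewrite big_nil -[RHS]f1; congr f; apply: val_inj.
have s'r : reduced s by apply: path_sorted sr.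
rewrite big_cons -(IH s'r).
have -> : letter_eval g a = f (@FreeGroup T [:: a] isT).
  by case: a {IH sr} => x [] /=; rewrite ?fV // fg.
rewrite -fM; congr f; apply: val_inj => /=.
by case: s sr {IH s'r} => //= b s /andP[/negPf->].
Qed.

Definition word_image (k : nat) (w : free_group 'I_k) (gT : finGroupType)
    (G : {set gT}) : {set gT} :=
  [set word_eval g w | g : {ffun 'I_k -> gT} in ffun_on G].

Section IsometryGroups.
Local Open Scope ring_scope.
(* Matrices act on row vectors from the right; the natural module has         *)
(* dimension m.+1 because {'GL_n[F]} is built on 'M_n.-1.+1.                  *)
Variables (F : finFieldType) (m : nat).
Local Notation V := 'rV[F]_m.+1.

Definition form_isometries (B : V -> V -> F) : {set {'GL_m.+1[F]}} :=
  [set g : {'GL_m.+1[F]} | [forall u : V, forall v : V,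
              B (u *m GLval g) (v *m GLval g) == B u v]].

Definition quadratic_isometries (Q : V -> F) : {set {'GL_m.+1[F]}} :=
  [set g : {'GL_m.+1[F]} | [forall u : V, Q (u *m GLval g) == Q u]].

Lemma form_isometries_group_set B : group_set (form_isometries B).
Proof.
apply/group_setP; split=> [|g h]; rewrite !inE.
  by apply/'forall_'forall_eqP => u v; rewrite /= !mulmx1.
move=> /'forall_'forall_eqP gB /'forall_'forall_eqP hB.
by apply/'forall_'forall_eqP => u v; rewrite /= !mulmxA hB gB.
Qed.
Canonical form_isometries_group B := Group (form_isometries_group_set B).

Lemma quadratic_isometries_group_set Q : group_set (quadratic_isometries Q).
Proof.
apply/group_setP; split=> [|g h]; rewrite !inE.
  by apply/'forall_eqP => u; rewrite /= !mulmx1.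
move=> /'forall_eqP gQ /'forall_eqP hQ.
by apply/'forall_eqP => u; rewrite /= !mulmxA hQ gQ.
Qed.
Canonical quadratic_isometries_group Q := Group (quadratic_isometries_group_set Q).

Definition polar (Q : V -> F) (u v : V) : F := Q (u + v) - Q u - Q v.

Definition quadratic_form (Q : V -> F) : Prop :=
  (forall a u, Q (a *: u) = a ^+ 2 * Q u) /\ bilinear_for *%R *%R (polar Q).

(* Q does not vanish on nonzero vectors of the radical of its polar form.  In *)
(* odd characteristic, and in even dimension over a finite field, this says   *)
(* that the polar form is nondegenerate; in characteristic 2 and odd          *)
(* dimension, where the polar form is always degenerate, it says that the     *)
(* radical is a line on which Q is nonzero.                                   *)
Definition nonsingular_quadratic (Q : V -> F) : Prop :=
  forall u, (forall v, polar Q u v = 0) -> Q u = 0 -> u = 0.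

(* A subspace is given as the row space of a square matrix.                   *)
Definition totally_singular (Q : V -> F) (U : 'M[F]_m.+1) : bool :=
  [forall u : V, (u <= U)%MS ==> (Q u == 0)].

Definition witt_index (Q : V -> F) : nat :=
  \max_(U : 'M[F]_m.+1 | totally_singular Q U) \rank U.

(* The type of a nonsingular form in dimension 2n': + for Witt index n' and   *)
(* - for Witt index n' - 1.                                                   *)
Inductive classical_group (q : nat) : {group {'GL_m.+1[F]}} -> Prop :=
| classical_GL :
    #|F| = q -> (2 <= m.+1)%N ->
    classical_group q [set: {'GL_m.+1[F]}]%G
| classical_Sp (n' : nat) (B : {skew_symmetric V}) :
    #|F| = q -> (1 <= n')%N -> m.+1 = (2 * n')%N ->
    (forall u, B u u = 0) -> nondegenerate B ->
    classical_group q (form_isometries_group B)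
| classical_GO_odd (n' : nat) (Q : V -> F) :
    #|F| = q -> (1 <= n')%N -> m.+1 = (2 * n' + 1)%N ->
    quadratic_form Q -> nonsingular_quadratic Q ->
    classical_group q (quadratic_isometries_group Q)
| classical_GO_plus (n' : nat) (Q : V -> F) :
    #|F| = q -> (1 <= n')%N -> m.+1 = (2 * n')%N ->
    quadratic_form Q -> nonsingular_quadratic Q -> witt_index Q = n' ->
    classical_group q (quadratic_isometries_group Q)
| classical_GO_minus (n' : nat) (Q : V -> F) :
    #|F| = q -> (1 <= n')%N -> m.+1 = (2 * n')%N ->
    quadratic_form Q -> nonsingular_quadratic Q -> witt_index Q = n'.-1 ->
    classical_group q (quadratic_isometries_group Q)
| classical_GU (conj : {rmorphism F -> F}) (B : {hermitian_sym V for conj}) :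
    #|F| = (q ^ 2)%N -> (forall x, conj x = x ^+ q) -> (2 <= m.+1)%N ->
    nondegenerate B ->
    classical_group q (form_isometries_group B).

Definition rank_dist (R : realType) (g h : {'GL_m.+1[F]}) : R :=
  (\rank (GLval g - GLval h))%:R / m.+1%:R.

End IsometryGroups.

(* inf set0 = 0 here, so this is meaningful for nonempty Y only; word images  *)
(* of groups are nonempty by word_image1.                                     *)
Definition eps_dense (R : realType) (T : Type) (d : T -> T -> R)
    (X Y : set T) (eps : R) : Prop :=
  forall x, X x -> (inf [set d x y | y in Y]%classic <= eps)%R.

Lemma word_image1 (k : nat) (w : free_group 'I_k) (gT : finGroupType)
    (G : {group gT}) : (1 \in word_image w G)%g.
Proof.
apply/imsetP; exists [ffun=> 1%g]; first by apply/ffun_onP => i; rewrite ffunE.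
rewrite /word_eval big1 // => -[i b] _.
by rewrite /letter_eval ffunE /= invg1 if_same.
Qed.

Lemma word_image_sub (k : nat) (w : free_group 'I_k) (gT : finGroupType)
    (G : {group gT}) : word_image w G \subset G.
Proof.
apply/fintype.subsetP => _ /imsetP[g /ffun_onP gG ->].
apply: group_prod => -[i b] _; rewrite /letter_eval /=.
by case: b; rewrite ?groupV gG.
Qed.

(* Main.v *)
(* Choose a unitriangular integer representation of the free group in which w   *)
(* acts on row vectors by moving only the last coordinate, by a nonzero multiple *)
(* g of the first one. Truncating the coordinates to large boxes and recording  *)
(* the last one modulo g, the quotient being kept as a weight, gives            *)
(* permutations of a finite set X, weighted by integers, such that w fixes most *)
(* points with total weight 1. The corresponding monomial matrices, with        *)
(* weights n replaced by al ^ n, have w-value close to al tensor 1_X, for every *)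
(* invertible al over every field; here |X| depends on w and the error only.    *)
(*                                                                              *)
(* So it is enough to bring an isometry g, by a change of small rank, to the    *)
(* form of an orthogonal sum of blocks al tensor 1_X (on U + U*, with U totally *)
(* isotropic, al acting on U and its inverse adjoint on U* ) and of a block of  *)
(* bounded dimension. Such blocks are split off one at a time. If f(g) has      *)
(* small rank for some f of bounded degree d, taken minimal, then there are     *)
(* |X| vectors in ker f(g) generating a free F[X]/(f)-module, which is an exact *)
(* block. Otherwise there are vectors x with x, xg, .., xg^L independent for a  *)
(* large L, and g times the isometry exchanging x and xg^D permutes             *)
(* x, xg, .., xg^(D-1) cyclically. Existence of the vectors is a count over the *)
(* finite field F, and isotropy comes from the nontrivial zeros of forms in     *)
(* three variables over F.                                                      *)
From mathcomp Require Import boolp classical_sets reals.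
Require Import Defs.
From mathcomp Require Import all_boot all_order all_algebra all_fingroup.
From mathcomp Require Import mxabelem finfield.
From mathcomp.real_closed Require Import mxtens.
From mathcomp Require Import zify ring.

Set Implicit Arguments.
Unset Strict Implicit.
Unset Printing Implicit Defensive.

Import Order.TTheory GRing.Theory Num.Theory.

Local Open Scope ring_scope.

(** * The action of a word on integer rows *)

(** Being close to a word value passes to orthogonal sums, with errors adding up. So it suffices to
    find one family of blocks on which every element is close to a word value, uniformly in the
    field, and to break every isometry, up to small rank, into such blocks. They are [al *t 1%:M],
    with a multiplicity [M] that depends only on the word and the precision.

    [word_tensor] treats the blocks. In a unitriangular action of the free group, a nontrivial word
    can be made to add a nonzero multiple of the first coordinate to the last one and to do nothing
    else ([row_word_central]). Truncating the coordinates ([tower_levelS]) gives finitely many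
    points, nearly all of which the word fixes with total weight [1] ([weighted_permutations]).
    Weights become exponents of [al]; powers of one matrix commute, so nothing but invertibility of
    [al] matters.

    [GL_splits] and [form_splits] find the blocks through the alternative of [exists_string_family].
    If a polynomial of bounded degree nearly annihilates [g], strings of vectors killed by it span
    an invariant subspace ([close_polynomial]). If none does, there are long independent strings,
    and a change of rank at most [M], or [2 * M] when there is a form, closes them into cycles of
    length [D.+1], a relative cost of [1 / D.+1]. When a form is present, the block must be totally
    isotropic and paired with a dual one, so that a hyperbolic summand splits off
    ([hyperbolic_iso]). The isotropy rests on zeros of diagonal forms in three variables
    ([norm_isotropic_id], [norm_isotropic_frobenius]) through [totally_isotropic_subspace].

    [splits_word_dense] iterates the splitting. Each step errs by a small proportion of the
    dimension it removes, and the piece left at the end has bounded dimension, which is negligible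
    for large [n]. *)

Section RowAction.
Variable T : choiceType.
Implicit Types (a b : T * bool) (c d : seq T) (s : seq (T * bool)).
Implicit Types (x y : nat -> int).

Definition letter_sign a : int := if a.2 then -1 else 1.

(** A generator acts as [1 + N], where [N] sums the elementary matrices at [(j, j.+1)] over the
    positions [j] at which [c] has it, and its inverse letter as [1 - N]. These are mutually inverse
    when neighbours in [c] differ, for then [N] squares to zero; hence the condition [sorted
    [rel i j | i != j] c] below. *)
Definition row_letter c x a (j : nat) : int :=
  if j is j'.+1 then
    x j + (if onth c j' == Some a.1 then letter_sign a * x j' else 0)
  else x 0%N.

Lemma row_letterS c x a j : row_letter c x a j.+1 =
  x j.+1 + (if onth c j == Some a.1 then letter_sign a * x j else 0).
Proof. by []. Qed.

Definition row_word c s x := foldl (row_letter c) x s.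

Lemma row_word_rcons c s a x :
  row_word c (rcons s a) x = row_letter c (row_word c s x) a.
Proof. by rewrite /row_word foldl_rcons. Qed.

Lemma row_word0 c s x : row_word c s x 0%N = x 0%N.
Proof. by elim/last_ind: s => // s a IH; rewrite row_word_rcons /= IH. Qed.

Lemma row_word_local c s x y m : (forall j, (j <= m)%N -> x j = y j) ->
  forall j, (j <= m)%N -> row_word c s x j = row_word c s y j.
Proof.
move=> exy; elim/last_ind: s => // s a IH [|j] jm.
  by rewrite !row_word0 exy.
by rewrite !row_word_rcons /= !IH // ltnW.
Qed.

Lemma row_word_cat c d s x j : (j <= size c)%N ->
  row_word (c ++ d) s x j = row_word c s x j.
Proof.
elim/last_ind: s j => // s a IH [|j] jc; first by rewrite !row_word0.
rewrite !row_word_rcons /= !IH ?(ltnW jc) //.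
suff -> : onth (c ++ d) j = onth c j by [].
by elim: c j jc {IH} => [|i c IHc] [|j] //= /IHc.
Qed.

Lemma row_word_behead i c s x j : x 0%N = 0 ->
  row_word (i :: c) s x j.+1 = row_word c s (fun l => x l.+1) j.
Proof.
move=> x0; elim/last_ind: s j => // s a IH j.
rewrite !row_word_rcons /= IH; case: j => [|j]; last by rewrite /= !IH.
by rewrite (row_word0 (i :: c)) x0 mulr0 if_same addr0 /= row_word0.
Qed.

Lemma row_word_linear c s z x y j :
  row_word c s (fun l => z * x l + y l) j = z * row_word c s x j + row_word c s y j.
Proof.
elim/last_ind: s j => // s a IH [|j]; first by rewrite !row_word0.
rewrite !row_word_rcons /= !IH; case: ifP => _; ring.
Qed.

Definition unit_row : nat -> int := fun j => (j == 0%N)%:R.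

(* The word acts on the first basis row: with one coordinate per syllable, the  *)
(* last coordinate is the product of the exponents of the syllables.            *)
Lemma row_word_syllables s a : reduced (rcons s a) ->
  exists c (A : int) (n : nat), [/\ A != 0, sorted [rel i j | i != j] (rcons c a.1)
  & forall d, ohead d != Some a.1 ->
    [/\ row_word (rcons c a.1 ++ d) (rcons s a) unit_row (size c) = A,
      row_word (rcons c a.1 ++ d) (rcons s a) unit_row (size c).+1
        = letter_sign a * n.+1%:Z * A
    & forall j, ((size c).+1 < j)%N ->
      row_word (rcons c a.1 ++ d) (rcons s a) unit_row j = 0]].
Proof.
have onthc c i d (l : nat) : (l <= size c)%N ->
    onth (rcons c i ++ d) l = if (l == size c)%N then Some i else onth c l.
  by elim: c l => [|i' c IH] [|l] //= /IH->.
elim/last_ind: s a => [|s b IH] a.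
  move=> _; exists [::], 1, 0%N; split=> //= d da; split=> //.
    by rewrite /row_word /= eqxx /unit_row /= add0r mulr1.
  by case=> [|[|j]] //= _; rewrite /row_word /= /unit_row /= mulr0 if_same.
move=> red; have /IH [c [A [n [A0 sc Hc]]]] : reduced (rcons s b).
  by move: red; rewrite /reduced -(cats1 _ a) => /cat_sorted2[].
have ab : a != flip b.
  move: red; rewrite /reduced; case: (s) => [|e s'] /=; first by rewrite andbT.
  by rewrite !rcons_path last_rcons /= => /andP[].
(* If the generator is that of the previous letter, reducedness forces the same sign and the last
   syllable grows. Otherwise a new syllable opens: [c] is extended, and the last coordinate so far
   becomes the new [A]. *)
case: (eqVneq a.1 b.1) => [eab|nab].
  have {ab} eab : a = b.
    move: ab eab; case: a b {red IH sc Hc} => [i x] [j y] /= + ij.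
    by rewrite ij /flip xpair_eqE eqxx /=; case: x; case: y.
  exists c, A, n.+1; split=> //; first by rewrite eab.
  move=> d; rewrite !eab => da; have [H1 H2 H3] := Hc _ da.
  have onth_pred : forall l, (l < size c)%N -> l.+1 = size c ->
      onth (rcons c b.1 ++ d) l != Some b.1.
    move=> l lc elc; rewrite onthc; last by rewrite ltnW.
    rewrite ltn_eqF //; apply: contraTneq sc => ecb.
    move: elc ecb; elim/last_ind: (c) => // c' i _; rewrite size_rcons => -[->].
    have -> : onth (rcons c' i) (size c') = Some i.
      by elim: c' => //= ? ?.
    case=> ->; case: c' => [|i' c'] /=; first by rewrite eqxx.
    by rewrite !rcons_path last_rcons /= eqxx andbF.
  split.
  - rewrite row_word_rcons; case ec : (size c) => [|l] /=.
      by rewrite -H1 ec.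
    rewrite -ec H1 (negPf (onth_pred l _ _)) ?ec ?addr0 //.
  - rewrite row_word_rcons /= H1 H2 onthc // !eqxx.
    by rewrite -[n.+2]addn1 PoszD; ring.
  - case=> // j; rewrite ltnS leq_eqVlt => /orP[/eqP<-|jc]; last first.
      by rewrite row_word_rcons /= !H3 ?mulr0 ?if_same // ltnW.
    rewrite row_word_rcons /= H3 //.
    suff /negPf-> : onth (rcons c b.1 ++ d) (size c).+1 != Some b.1 by [].
    by move: da; rewrite -cats1 -catA; case: d {H1 H2 H3 onth_pred} => [|i d] /=;
       elim: (c).
exists (rcons c b.1), (letter_sign b * n.+1%:Z * A), 0%N; split.
- by rewrite !mulf_neq0 // /letter_sign; case: b.2.
- case: c sc {Hc} => [|i c] /=; first by rewrite andbT eq_sym.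
  by move=> sc; rewrite rcons_path sc last_rcons /= eq_sym.
move=> d da; have := Hc (a.1 :: d); rewrite -cat_rcons => -[].
  by apply: contra nab => /eqP[->].
move=> H1 H2 H3; rewrite row_word_rcons size_rcons; split.
- rewrite /= H1 H2; case: eqP => [|_]; last by rewrite addr0.
  rewrite cat_rcons onthc // eqxx => -[/eqP]; by rewrite eq_sym (negPf nab).
- by rewrite row_letterS H2 H3 // onthc ?size_rcons // !eqxx add0r mulr1.
case=> // j jc; rewrite /= !H3 ?mulr0 ?if_same //; last by lia.
Qed.

Definition row_trivial c s :=
  forall x j, (j <= size c)%N -> row_word c s x j = x j.

(* For c of minimal length with nontrivial action, deleting the first or the   *)
(* last letter of c makes the action trivial; only the corner can move.        *)
Lemma row_word_central s : reduced s -> s != [::] ->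
  exists i c (g : int), [/\ g != 0, sorted [rel i j | i != j] (i :: c),
    forall x j, (j <= size c)%N -> row_word (i :: c) s x j = x j
  & forall x, row_word (i :: c) s x (size c).+1 = x (size c).+1 + g * x 0%N].
Proof.
move=> red s0.
have [c0 sc0 nt0] : exists2 c, sorted [rel i j | i != j] c & ~ row_trivial c s.
  case/lastP: s red s0 => // s a /row_word_syllables [c [A [n [A0 sc Hc]]]] _.
  exists (rcons c a.1) => // tr; have [] := Hc [::] isT.
  rewrite cats0 => _ H _; move: H; rewrite tr ?size_rcons // /unit_row /= => /esym/eqP.
  by rewrite !mulf_eq0 (negPf A0) orbF /letter_sign; case: a.2.
have ltm := ltnSn (size c0); move: {2}(size c0).+1 ltm => m ltm.
elim: m c0 ltm sc0 nt0 => // m IH [|i c] /= + sc nt.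
  by case: nt => x [|j] // _; rewrite row_word0.
rewrite ltnS => cm; have [tr1|nt1] := pselect (row_trivial c s); last first.
  by apply: IH cm _ nt1; apply: path_sorted sc.
have [i' [c' ec]] : exists i' c', i :: c = rcons c' i'.
  by case/lastP: {+}c => [|c' i']; [exists i, [::] | exists i', (i :: c')].
have [tr2|nt2] := pselect (row_trivial c' s); last first.
  apply: IH nt2; first by move: cm (congr1 size ec); rewrite size_rcons /= => cm [<-].
  move: sc; rewrite [path _ _ _](_ : _ = sorted [rel i j | i != j] (i :: c)) //.
  by rewrite ec -cats1 => /cat_sorted2[].
have szc : size c' = size c by move: (congr1 size ec); rewrite size_rcons /= => -[].
have low x j : (j <= size c)%N -> row_word (i :: c) s x j = x j.
  by move=> jc; rewrite ec -cats1 row_word_cat ?szc // tr2 ?szc.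
have top x : row_word (i :: c) s x (size c).+1 =
    x (size c).+1 + row_word (i :: c) s unit_row (size c).+1 * x 0%N.
  (* Without its first coordinate, [x] only sees the shorter sequence [c], on which the word acts
     trivially. *)
  pose y j := if j is 0%N then 0 else x j.
  have ex j : x j = x 0%N * unit_row j + y j.
    by case: j => [|j]; rewrite /unit_row /= ?mulr1 ?addr0 ?mulr0 ?add0r.
  rewrite (@row_word_local _ _ x (fun l => x 0%N * unit_row l + y l) (size c).+1) //.
  by rewrite row_word_linear [X in _ + X]row_word_behead // tr1 //= addrC mulrC.
exists i, c, (row_word (i :: c) s unit_row (size c).+1); split=> //.
apply/eqP => g0; case: nt => x j; rewrite leq_eqVlt => /orP[/eqP->|/low->//].
by rewrite top g0 mul0r addr0.
Qed.

End RowAction.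

(** * Weighted permutations *)

Section Walk.
Variables (T : Type) (X : finType) (sig : T -> {perm X}) (kap : T -> X -> int).
Implicit Types (a : T * bool) (s : seq (T * bool)) (z : X * int).

(** An inverse letter has to undo a forward move, so its weight is read at the point where it
    arrives. *)
Definition walk_letter z a : X * int :=
  if a.2 then ((sig a.1)^-1%g z.1, z.2 - kap a.1 ((sig a.1)^-1%g z.1))
  else (sig a.1 z.1, z.2 + kap a.1 z.1).

Definition walk z s := foldl walk_letter z s.

Lemma walk_rcons z s a : walk z (rcons s a) = walk_letter (walk z s) a.
Proof. by rewrite /walk foldl_rcons. Qed.

Lemma walk_shift p Y Z s :
  walk (p, Y + Z) s = ((walk (p, Y) s).1, (walk (p, Y) s).2 + Z).
Proof.
elim/last_ind: s => // s a IH; rewrite !walk_rcons IH /walk_letter /=.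
by case: a.2; rewrite /= addrAC.
Qed.

Lemma walk_bound (B : nat) z s : (forall i p, `|kap i p| <= B) ->
  `|(walk z s).2 - z.2| <= (size s * B)%N.
Proof.
move=> kB; elim/last_ind: s => [|s a IH]; first by rewrite subrr normr0.
rewrite walk_rcons size_rcons /walk_letter; move: IH; case: (walk z s) => p Y /=.
case: a.2 => /= IH.
  by have := kB a.1 ((sig a.1)^-1%g p); rewrite mulSn; lia.
by have := kB a.1 p; rewrite mulSn; lia.
Qed.

Variable L : nat.

Definition resid (t : int) : 'I_L.+1 := inord `|(t %% L.+1%:Z)%Z|%N.

Lemma residE (t : int) : (resid t)%:Z = (t %% L.+1%:Z)%Z.
Proof.
have t0 : (0 <= t %% L.+1%:Z)%Z by apply: modz_ge0.
have tL : (t %% L.+1%:Z < L.+1%:Z)%Z by apply: ltz_pmod.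
by rewrite /resid inordK; lia.
Qed.

(** The residue of the accumulated integer joins the point; the quotient survives as the new weight
    [carry]. *)
Definition skew_fun i (p : X * 'I_L.+1) : X * 'I_L.+1 :=
  (sig i p.1, resid ((p.2 : nat)%:Z + kap i p.1)).

Lemma skew_fun_inj i : injective (skew_fun i).
Proof.
move=> [p y] [q z] [/perm_inj <- /(congr1 (fun u : 'I__ => (u : nat)%:Z))].
rewrite !residE => /eqP; rewrite eqz_modDr => /eqP.
by rewrite !modz_small ?ltz_nat ?ltn_ord // => -[/val_inj->].
Qed.

Definition skew_perm i := perm (@skew_fun_inj i).

Definition carry i (p : X * 'I_L.+1) : int :=
  (((p.2 : nat)%:Z + kap i p.1) %/ L.+1%:Z)%Z.

Lemma skew_carry i (p : X * 'I_L.+1) :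
  ((skew_perm i p).2 : nat)%:Z + carry i p * L.+1%:Z = (p.2 : nat)%:Z + kap i p.1.
Proof. by rewrite permE /= residE addrC -divz_eq. Qed.

Lemma skew1 i (p : X * 'I_L.+1) : (skew_perm i p).1 = sig i p.1.
Proof. by rewrite permE. Qed.

End Walk.

Lemma walk_fst (T : Type) (X : finType) (sig : T -> {perm X}) kap kap' z z' s :
  z.1 = z'.1 -> (walk sig kap z s).1 = (walk sig kap' z' s).1.
Proof.
move=> e; elim/last_ind: s => // s a IH.
by rewrite !walk_rcons /walk_letter IH; case: a.2.
Qed.

(* The skew product by Z/(L+1), together with its carry, is the original walk   *)
(* with the integer coordinate written in base L+1.                             *)
Lemma walk_skew (T : Type) (X : finType) (sig : T -> {perm X}) kap L
    (p : X) (y : 'I_L.+1) K s :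
  let z := walk (skew_perm sig kap L) (@carry _ _ kap L) ((p, y), K) s in
  walk sig kap (p, (y : nat)%:Z + K * L.+1%:Z) s
    = (z.1.1, (z.1.2 : nat)%:Z + z.2 * L.+1%:Z).
Proof.
elim/last_ind: s => //= s a; rewrite !walk_rcons.
case: (walk _ _ (p, y, K) s) => -[q w] K' /= ->; rewrite /walk_letter /=.
case: a.2 => /=.
  set q' := ((skew_perm sig kap L a.1)^-1)%g (q, w).
  have eq' : skew_perm sig kap L a.1 q' = (q, w) by rewrite permKV.
  have := skew_carry sig kap a.1 q'; have := skew1 sig kap a.1 q'; rewrite eq' /=.
  move=> e1; have -> : ((sig a.1)^-1)%g q = q'.1 by rewrite e1 permK.
  by move=> /(canRL (addrK _)) e2; congr (_, _); rewrite e2; ring.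
have := skew_carry sig kap a.1 (q, w); have := skew1 sig kap a.1 (q, w).
case: (skew_perm _ _ _ _ _) => q' w' /= -> /(canLR (addrK _)) e; congr (_, _).
by rewrite -addrA [_ + kap _ _]addrC addrA -e; ring.
Qed.

Section Tower.
Variables (T : choiceType) (s : seq (T * bool)) (c : seq T).

Definition set_coord (x : nat -> int) j Y : nat -> int :=
  fun l => if l == j then Y else x l.

(* A finite model of the first j coordinates, the set ~: good being the points  *)
(* from which reading s may leave the box; kap drives coordinate j+1.            *)
Definition tower_level (E j : nat) : Prop :=
  exists (X : finType) (sig : T -> {perm X}) (kap : T -> X -> int) (B : nat)
         (good : {set X}) (xi : X -> nat -> int),
  [/\ (#|~: good| * E <= #|X|)%N /\ (0 < #|X|)%N,
      (forall i p, `|kap i p| <= B) /\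
        (forall i p, onth c j != Some i -> kap i p = 0),
      (forall p, p \in good -> xi p 0%N = 1),
      (forall p, p \in good -> (walk sig kap (p, 0) s).1 = p)
    & forall p t Y, p \in good -> (t <= size s)%N ->
      (walk sig kap (p, Y) (take t s)).2 =
      row_word c (take t s) (set_coord (xi p) j.+1 Y) j.+1].

Lemma tower_level0 E : tower_level E 0.
Proof.
exists unit, (fun _ => 1%g), (fun i _ => (onth c 0 == Some i)%:R), 1%N, setT,
  (fun _ => unit_row); split=> //.
- by rewrite setCT cards0 card_unit.
- by split=> i p; [case: eqP | move/negPf->].
- by move=> p _; case: p; case: (walk _ _ _ _) => -[].
- move=> p t Y _ _; elim/last_ind: (take t s) => [|u a IH] //.
  rewrite walk_rcons row_word_rcons row_letterS -IH row_word0 /set_coord /=.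
  rewrite /walk_letter /letter_sign; case: a.2 => /=; case: eqP => _ /=;
    by rewrite /unit_row ?mulr1 ?subr0 ?addr0.
Qed.

Hypothesis c_sorted : sorted [rel i j | i != j] c.

Lemma onth_sorted j i : onth c j.+1 = Some i -> onth c j != Some i.
Proof.
elim: c c_sorted j => [|i0 d IH] //= sd [|j]; last first.
  by apply: IH; apply: path_sorted sd.
by case: d sd {IH} => //= i1 d /andP[n01 _] [<-]; apply: contra n01 => /eqP[->].
Qed.

Variable r : nat.
Hypothesis s_trivial :
  forall x j, (j <= r)%N -> row_word c s x j = x j.

(** Coordinate [j.+1], so far a weight, is truncated to [L.+1] residues. The word moves it by at
    most [R], so from the middle [mid] of the box no carry occurs and the residue is the true
    coordinate, which the word restores by [s_trivial]. The bad points of the previous level and the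
    two margins of width [R] each use up half of the allowance. *)
Lemma tower_levelS E j : (j < r)%N -> tower_level (2 * E) j -> tower_level E j.+1.
Proof.
move=> jr [X [sig [kap [B [good [xi]]]]]].
case=> -[cg X0] [kB k0] xi0 fixg wg.
pose R := (size s * B)%N; pose L := (4 * R * E)%N.
pose mid := [set y : 'I_L.+1 | (R <= y)%N && (y + R < L.+1)%N].
pose good' := setX good mid.
pose sig' := skew_perm sig kap L.
pose kap' i (p : X * 'I_L.+1) : int :=
  if onth c j.+1 == Some i then (p.2 : nat)%:Z else 0.
pose xi' (p : X * 'I_L.+1) := set_coord (xi p.1) j.+1 (p.2 : nat)%:Z.
have mid_walk p (y : 'I_L.+1) t K : p \in good -> y \in mid -> (t <= size s)%N ->
    ((walk sig' kap' ((p, y), K) (take t s)).1.2 : nat)%:Z =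
    row_word c (take t s) (set_coord (xi p) j.+1 (y : nat)%:Z) j.+1.
  move=> pg; rewrite inE => /andP[Ry yR] ts; rewrite -wg //.
  have -> : (walk sig' kap' ((p, y), K) (take t s)).1 =
     (walk sig' (@carry _ _ kap L) ((p, y), 0) (take t s)).1.
    exact: walk_fst.
  have := @walk_skew _ _ sig kap L p y 0 (take t s); rewrite mul0r addr0 /=.
  have := @walk_bound _ _ sig kap B (p, (y : nat)%:Z) (take t s) kB.
  case: (walk sig kap _ _) => q Y /= bnd [_ eY].
  have {bnd} : `|Y - y%:Z| <= R%:Z.
    by apply: le_trans bnd _; rewrite lez_nat leq_mul2r size_take_min geq_minr orbT.
  move: eY; rewrite /sig'.
  case: (walk _ _ _ _) => -[q' w] K' /= -> bnd.
  have : (w < L.+1)%N := ltn_ord w.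
  move: bnd Ry yR; move: (w : nat) (y : nat) => w' y'.
  rewrite -[L.+1%:Z]/(Posz L.+1); move: (L.+1) => l bnd Ry yR wl.
  suff -> : K' = 0 by rewrite mul0r addr0.
  by nia.
exists (X * 'I_L.+1)%type, sig', kap', L, good', xi'; split.
- split; last by rewrite card_prod card_ord muln_gt0 X0.
  have sub : ~: good' \subset setX (~: good) setT :|: setX setT (~: mid).
    apply/subsetP => -[p y]; rewrite !inE /= negb_and andbT.
    by case: (p \in good).
  have card_mid : (#|~: mid| <= 2 * R)%N.
    have sub' : ~: mid \subset [set y : 'I_L.+1 | (y < R)%N] :|:
        [set y : 'I_L.+1 | (rev_ord y < R)%N].
      by apply/subsetP => y; rewrite !inE /=; have := ltn_ord y; lia.
    apply: leq_trans (subset_leq_card sub') _.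
    have card_lt : (#|[set y : 'I_L.+1 | (y < R)%N]| <= R)%N.
      rewrite cardE -(size_map val) -[X in (_ <= X)%N](size_iota 0).
      apply: uniq_leq_size.
        by rewrite map_inj_uniq ?enum_uniq //; apply: val_inj.
      by move=> _ /mapP[y + ->]; rewrite mem_enum inE mem_iota.
    apply: leq_trans (leq_card_setU _ _) _; rewrite mul2n -addnn leq_add //.
    have -> : [set y : 'I_L.+1 | (rev_ord y < R)%N] =
        (@rev_ord L.+1) @: [set y : 'I_L.+1 | (y < R)%N].
      apply/setP => y; rewrite inE; apply/idP/imsetP => [yR|[z + ->]].
        by exists (rev_ord y); rewrite ?inE // rev_ordK.
      by rewrite inE rev_ordK.
    by rewrite card_imset //; apply: rev_ord_inj.
  have := leq_trans (subset_leq_card sub) (leq_card_setU _ _).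
  rewrite !cardsX !cardsT card_ord card_prod card_ord => cg'.
  have h1 : (#|X| * #|~: mid| <= #|X| * (2 * R))%N by rewrite leq_mul2l card_mid orbT.
  move: cg cg' h1; rewrite /L; move: (#|~: good|) (#|X|) (#|~: good'|) (#|~: mid|).
  by move=> bad nX bad' nm h h1 h2; nia.
- split=> i p; last by rewrite /kap' => /negPf->.
  rewrite /kap'; case: ifP => _; last by rewrite normr0.
  by rewrite ger0_norm // lez_nat -ltnS ltn_ord.
- by move=> [p y]; rewrite !inE /= /xi' /set_coord /= => /andP[/xi0].
- move=> [p y]; rewrite in_setX /= => /andP[pg ym].
  have := mid_walk p y (size s) 0 pg ym (leqnn _); rewrite take_size s_trivial //.
  rewrite /set_coord eqxx => -[] /val_inj.
  have := fixg _ pg; case E1: (walk sig' kap' _ _) => [[q w] K] /= E2 ->.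
  congr (_, _); rewrite -[RHS]E2.
  have := @walk_skew _ _ sig kap L p y 0 s; rewrite mul0r addr0 /=.
  have : (walk sig' (@carry _ _ kap L) ((p, y), 0) s).1 = (q, w).
    by rewrite -[RHS](congr1 fst E1); apply: walk_fst.
  rewrite /sig'; case: (walk (skew_perm _ _ _) _ _ _) => q' K' /= -> /(congr1 fst) /= <-.
  exact: walk_fst.
- move=> [p y] t Y; rewrite in_setX /= => /andP[pg ym] ts.
  elim: t ts => [|t IH] ts; first by rewrite take0 /row_word /= /set_coord eqxx.
  have [a ea] : exists a, take t.+1 s = rcons (take t s) a.
    by case: s ts => // a0 s' ts; exists (nth a0 (a0 :: s') t); rewrite (take_nth a0).
  have := mid_walk p y t Y pg ym (ltnW ts); have {}IH := IH (ltnW ts).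
  rewrite ea !walk_rcons row_word_rcons row_letterS -IH {IH}.
  (* Since neighbours in [c] differ, a generator that drives the new coordinate leaves coordinate
     [j.+1] alone. So its weight is the same before and after the move, as inverse letters
     require. *)
  have keep a1 z : onth c j.+1 = Some a1 -> (sig' a1 z).2 = z.2.
    move=> /onth_sorted /k0 ka; rewrite /sig' permE /= ka addr0.
    by apply/val_inj/eqP; rewrite /= -eqz_nat residE modz_small // ltz_nat ltn_ord.
  move: keep; rewrite /kap'; set o := onth c j.+1 => keep.
  case: (walk _ _ _ _) => -[q w] Y' /= e2.
  have <- : (w : nat)%:Z = row_word c (take t s) (set_coord (xi' (p, y)) j.+2 Y) j.+1.
    rewrite e2; apply: (@row_word_local _ _ _ _ _ j.+1) => // l lj.
    by rewrite /xi' /set_coord /=; case: (l == j.+1) => //; rewrite ltn_eqF.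
  rewrite /walk_letter /letter_sign /=.
  case: a.2 => /=; case: eqP => [ea1|_]; rewrite ?mul1r ?subr0 ?addr0 ?mulN1r //.
  by rewrite -(keep a.1) // permKV.
Qed.

Lemma tower_exists E : tower_level E r.
Proof.
suff H m : (m <= r)%N -> forall E, tower_level E m by apply: H.
elim: m => [|m IH] mr E'; first exact: tower_level0.
by apply: tower_levelS => //; apply: IH; apply: ltnW.
Qed.

End Tower.

(** At the top of the tower the word adds [g] to the last coordinate. Modulo [|g|] this returns to
    the starting point with carry [sgz g], which rescaling the weights by [sgz g] turns into [1].
    Every residue is good here, as the carry is recorded exactly. *)
Theorem weighted_permutations (T : choiceType) (s : seq (T * bool)) (E : nat) :
  reduced s -> s != [::] ->
  exists (X : finType) (sig : T -> {perm X}) (kap : T -> X -> int) (good : {set X}),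
  [/\ (#|~: good| * E <= #|X|)%N, (0 < #|X|)%N
    & forall p, p \in good -> walk sig kap (p, 0) s = (p, 1)].
Proof.
move=> red s0; have [i [c [g [g0 cs low top]]]] := row_word_central red s0.
have [X [sig [kap [B [good [xi]]]]]] := @tower_exists _ _ _ cs _ low E.
case=> -[cg X0] _ xi0 fixg wg; pose L := (`|g|.-1)%N.
exists (X * 'I_L.+1)%type, (skew_perm sig kap L),
  (fun i p => sgz g * carry kap i p), (setX good setT); split.
- have -> : ~: setX good [set: 'I_L.+1] = setX (~: good) setT.
    by apply/setP => -[p y]; rewrite !inE !andbT.
  by rewrite cardsX cardsT card_prod mulnAC leq_mul2r cg orbT.
- by rewrite card_prod card_ord muln_gt0 X0.
case=> p y; rewrite !inE andbT /= => pg.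
have scale z t : walk (skew_perm sig kap L) (fun i p => sgz g * carry kap i p)
      (z.1, sgz g * z.2) t =
    let z' := walk (skew_perm sig kap L) (@carry _ _ kap L) z t in (z'.1, sgz g * z'.2).
  elim/last_ind: t => //= t a; rewrite !walk_rcons => ->.
  by rewrite /walk_letter; case: a.2; rewrite /= ?mulrBr ?mulrDr.
have := scale ((p, y), 0) s; rewrite /= mulr0 => ->.
have := @walk_skew _ _ sig kap L p y 0 s; rewrite mul0r addr0 /=.
have := fixg _ pg; have := wg p (size s) 0 pg (leqnn _); rewrite take_size.
rewrite top /set_coord eqxx /= add0r xi0 // mulr1.
rewrite -(add0r (y : nat)%:Z) (walk_shift _ _ p 0).
case: (walk sig kap _ _) => q Y /= -> ->.
case: (walk _ _ _ _) => -[q' w] K /= [<- e].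
have eL : L.+1%:Z = sgz g * g.
  by rewrite /L prednK ?absz_gt0 // abszEsg.
have g2 : sgz g * sgz g = 1 by rewrite -expr2 sqr_sg g0.
have [ew eK] : w = y /\ K = sgz g.
  have e' : (w : nat)%:Z - (y : nat)%:Z = (sgz g - K) * L.+1%:Z.
    by rewrite mulrBl {1}eL mulrA g2 mul1r; lia.
  have eK : sgz g - K = 0.
    move: e' (ltn_ord w) (ltn_ord y); move: (w : nat) (y : nat) => w' y'.
    by move: (sgz g - K) (L) => k l; nia.
  split; last by lia.
  by apply: (@ord_inj L.+1); apply/eqP; rewrite -eqz_nat -subr_eq0 e' eK mul0r.
by rewrite ew eK g2.
Qed.

(** * Monomial matrices *)

Lemma mxrank_sum_le (F : fieldType) m n (I : finType) (P : pred I) (A : I -> 'M[F]_(m, n)) :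
  (\rank (\sum_(i | P i) A i)%R <= \sum_(i | P i) \rank (A i))%N.
Proof.
elim/big_rec2: _ => [|i r B _ le_r]; first by rewrite mxrank0.
by apply: leq_trans (mxrank_add _ _) _; rewrite leq_add2l.
Qed.

Section MatrixWords.
Variables (F : fieldType) (T : Type).

Definition mxletter n (g : T -> 'M[F]_n) (a : T * bool) : 'M[F]_n :=
  if a.2 then invmx (g a.1) else g a.1.

Definition mxword n (g : T -> 'M[F]_n) (s : seq (T * bool)) : 'M[F]_n :=
  foldl (fun A a => A *m mxletter g a) 1%:M s.

Lemma mxword_rcons n (g : T -> 'M[F]_n) s a :
  mxword g (rcons s a) = mxword g s *m mxletter g a.
Proof. by rewrite /mxword foldl_rcons. Qed.

Lemma mxletter_unit n (g : T -> 'M[F]_n) a :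
  (forall i, g i \in unitmx) -> mxletter g a \in unitmx.
Proof. by move=> ug; rewrite /mxletter; case: a.2; rewrite ?unitmx_inv. Qed.

Lemma mxword_unit n (g : T -> 'M[F]_n) s :
  (forall i, g i \in unitmx) -> mxword g s \in unitmx.
Proof.
move=> ug; elim/last_ind: s => [|s a IH]; first exact: unitmx1.
by rewrite mxword_rcons unitmx_mul IH mxletter_unit.
Qed.

End MatrixWords.

Section Monomial.
Variables (F : fieldType) (T : Type) (X : finType).
Variables (sig : T -> {perm X}) (kap : T -> X -> int).
Variables (d : nat) (al : 'M[F]_d.+1).
Hypothesis al_unit : al \in unitmx.

Let M := #|X|.

Definition monomial_mx i : 'M[F]_(d.+1 * M) :=
  \sum_(p : X) (al ^ (kap i p)) *t delta_mx (enum_rank p) (enum_rank (sig i p)).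

Lemma monomial_row i p (be : 'M[F]_d.+1) :
  (be *t delta_mx (0 : 'I_1) (enum_rank p)) *m monomial_mx i =
  (be *m al ^ (kap i p)) *t delta_mx (0 : 'I_1) (enum_rank (sig i p)).
Proof.
rewrite mulmx_sumr (bigD1 p) //= tensmx_mul mul_delta_mx big1 ?addr0 // => q qp.
rewrite tensmx_mul mul_delta_mx_0 ?tensmx0 //.
by rewrite (inj_eq enum_rank_inj) eq_sym.
Qed.

Lemma tens_delta_decomp m (D : 'M[F]_(d.+1 * M, m)) :
  D = \sum_(p : X) (1%:M *t delta_mx (enum_rank p) (0 : 'I_1)) *m
        ((1%:M *t delta_mx (0 : 'I_1) (enum_rank p)) *m D).
Proof.
transitivity ((1%:M *t (\sum_(p : X) delta_mx (enum_rank p) (enum_rank p)))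
    *m D : 'M_(d.+1 * M, m)).
  rewrite (reindex (@enum_val X xpredT)) /=; last first.
    by exists enum_rank => ? _; rewrite ?enum_rankK ?enum_valK.
  under eq_bigr do rewrite enum_valK.
  have -> : \sum_(j < #|X|) delta_mx j j = 1%:M :> 'M[F]_M.
    apply/matrixP => i j; rewrite summxE !mxE (bigD1 i) //= mxE eqxx /= big1 ?addr0.
      by rewrite eq_sym.
    by move=> k ki; rewrite mxE eq_sym (negPf ki).
  have -> : 1%:M *t 1%:M = 1%:M :> 'M[F]_(d.+1 * M).
    apply/matrixP => i j; case: (mxtens_indexP i) => i1 i2.
    case: (mxtens_indexP j) => j1 j2; rewrite tensmxE !mxE.
    rewrite (inj_eq (can_inj (@mxtens_indexK _ _))) xpair_eqE.
    by case: (i1 == j1); case: (i2 == j2); rewrite ?mulr1 ?mulr0.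
  by rewrite mul1mx.
have -> : 1%:M *t (\sum_(p : X) delta_mx (enum_rank p) (enum_rank p)) =
   \sum_(p : X) 1%:M *t delta_mx (enum_rank p) (enum_rank p) :> 'M[F]_(d.+1 * M).
  apply/matrixP => i j; rewrite !(mxE, summxE) mulr_sumr; apply: eq_bigr => p _.
  by rewrite !mxE.
rewrite mulmx_suml; apply: eq_bigr => p _.
by rewrite mulmxA tensmx_mul mul1mx mul_delta_mx.
Qed.

Lemma monomial_unit i : monomial_mx i \in unitmx.
Proof.
pose B : 'M[F]_(d.+1 * M) := \sum_(p : X)
  (al ^ (- kap i p)) *t delta_mx (enum_rank (sig i p)) (enum_rank p).
suff /mulmx1_unit[] : monomial_mx i *m B = 1%:M by [].
rewrite [LHS]tens_delta_decomp [RHS]tens_delta_decomp; apply: eq_bigr => p _.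
congr (_ *m _); rewrite mulmxA monomial_row mulmx1 mul1mx.
rewrite mulmx_sumr (bigD1 p) //= tensmx_mul mul_delta_mx big1 ?addr0 => [|q qp].
  by rewrite -[_ *m _]/(_ * _) -exprzDr ?subrr ?expr0z ?mul1mx //; rewrite mul1r.
rewrite tensmx_mul mul_delta_mx_0 ?tensmx0 //.
by rewrite (inj_eq enum_rank_inj) (inj_eq perm_inj) eq_sym.
Qed.

(** The blocks are powers of one matrix, so exponents add along the path of [p]. *)
Lemma monomial_word p s :
  (1%:M *t delta_mx (0 : 'I_1) (enum_rank p)) *m mxword monomial_mx s =
  (al ^ (walk sig kap (p, 0) s).2) *t
    delta_mx (0 : 'I_1) (enum_rank (walk sig kap (p, 0) s).1).
Proof.
elim/last_ind: s => [|s a IH]; first by rewrite mulmx1 expr0z.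
rewrite mxword_rcons mulmxA IH walk_rcons /walk_letter /mxletter.
case: (walk _ _ _ _) => q Y /=; case: a.2 => /=; last first.
  by rewrite monomial_row -[_ *m _]/(_ * _) -exprzDr.
apply: (canLR (mulmxK (monomial_unit _))); rewrite monomial_row.
by rewrite -[_ *m _]/(_ * _) -exprzDr // subrK permKV.
Qed.

Lemma monomial_word_rank (good : {set X}) s :
  (forall p, p \in good -> walk sig kap (p, 0) s = (p, 1)) ->
  (\rank (mxword monomial_mx s - al *t 1%:M)%R <= d.+1 * #|~: good|)%N.
Proof.
move=> Hg; rewrite [X in \rank X]tens_delta_decomp.
rewrite (bigID (mem good)) /= big1 ?add0r => [|p pg].
  apply: leq_trans (mxrank_sum_le _ _) _.
  have -> : (d.+1 * #|~: good| = \sum_(p | p \notin good) d.+1)%N.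
    by rewrite mulnC -sum_nat_const; apply: eq_bigl => p; rewrite inE.
  apply: leq_sum => p _; apply: leq_trans (mxrankM_maxr _ _) _.
  by apply: leq_trans (rank_leq_row _) _; rewrite muln1.
rewrite mulmxBr monomial_word Hg //= tensmx_mul mul1mx mulmx1 expr1z subrr.
by rewrite mulmx0.
Qed.

End Monomial.

(** [M] is the number of points of the permutation model, hence is fixed before the field, [d] and
    [al]. *)
Theorem word_tensor (T : choiceType) (s : seq (T * bool)) (E : nat) :
  reduced s -> s != [::] ->
  exists2 M : nat, (0 < M)%N & forall (F : fieldType) d (al : 'M[F]_d.+1),
  al \in unitmx -> exists2 A : T -> 'M[F]_(d.+1 * M),
    forall i, A i \in unitmx &
    (\rank (mxword A s - al *t 1%:M)%R * E <= d.+1 * M)%N.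
Proof.
move=> red s0; have [X [sig [kap [good [bad X0 Hg]]]]] := weighted_permutations E red s0.
exists #|X| => // F d al ual; exists (monomial_mx sig kap al).
  exact: monomial_unit.
apply: leq_trans (_ : d.+1 * #|~: good| * E <= _)%N.
  by rewrite leq_mul2r (monomial_word_rank ual Hg) orbT.
by rewrite -mulnA leq_mul2l.
Qed.

(** * Splitting off tensor blocks *)

Section Splitting.
Variables (F : fieldType) (Str : nat -> Type).
Variable iso : forall n, Str n -> 'M[F]_n -> Prop.
Hypothesis iso1 : forall n (s : Str n), iso s 1%:M.
Hypothesis iso_unit : forall n (s : Str n) g, iso s g -> g \in unitmx.

(* Up to rank |H| / D, g preserves a decomposition H + W with dim W = b, on     *)
(* which it acts as (al tensor 1_M, g'); Phi embeds GL(d.+1 * M) x Isom(W)      *)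
(* into the isometry group, with H of dimension kappa * (d.+1 * M).             *)
Definition splits (M D n : nat) (s : Str n) (g : 'M[F]_n) : Prop :=
  exists (b : nat) (s' : Str b) (g' : 'M[F]_b) (d : nat) (al : 'M[F]_d.+1)
    (kappa : nat) (Phi : 'M[F]_(d.+1 * M) -> 'M[F]_b -> 'M[F]_n),
  [/\ [/\ iso s' g', al \in unitmx, (0 < kappa)%N & n = (kappa * (d.+1 * M) + b)%N],
      (\rank (g - Phi (al *t 1%:M) g')%R * D <= kappa * (d.+1 * M))%N,
      Phi 1%:M 1%:M = 1%:M /\
        (forall A A' X X', A \in unitmx -> A' \in unitmx ->
           X \in unitmx -> X' \in unitmx ->
           Phi (A *m A') (X *m X') = Phi A X *m Phi A' X'),
      forall A X, A \in unitmx -> iso s' X -> iso s (Phi A X)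
    & forall A A' X X', A \in unitmx -> A' \in unitmx ->
        (\rank (Phi A X - Phi A' X')%R <= kappa * \rank (A - A')%R + \rank (X - X')%R)%N].

Variables (T : Type) (w : seq (T * bool)) (M e C : nat).
Hypothesis M_gt0 : (0 < M)%N.
Hypothesis w_tensor : forall d (al : 'M[F]_d.+1), al \in unitmx ->
  exists2 A : T -> 'M[F]_(d.+1 * M), forall i, A i \in unitmx &
    (\rank (mxword A w - al *t 1%:M)%R * (2 * e) <= d.+1 * M)%N.
Hypothesis step : forall n (s : Str n) g, (C <= n)%N -> iso s g ->
  splits M (2 * e) s g.

(** Induction on the dimension. Passing from [g] to [Phi], and from [al *t 1%:M] to a word value,
    each costs at most a proportion [1 / (2 * e)] of the dimension split off. Together the steps
    cost at most [n / e], and a remainder of dimension below [C] is given up. *)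
Lemma splits_word_dense n (s : Str n) g : iso s g ->
  exists2 h : T -> 'M[F]_n, forall i, iso s (h i) &
    (\rank (g - mxword h w)%R * e <= n + C * e)%N.
Proof.
elim/ltn_ind: n => n IH in s g *; move=> ig.
have [nC|Cn] := ltnP n C.
  exists (fun _ => 1%:M) => //; apply: leq_trans (leq_addl _ _).
  by rewrite leq_mul2r (leq_trans (rank_leq_row _)) ?orbT // ltnW.
have [b [s' [g' [d [al [ka [Phi [[ig' ual ka0 en] rg [P1 PM] iP rP]]]]]]]] := step Cn ig.
have bn : (b < n)%N by rewrite en -[X in (X < _)%N]add0n ltn_add2r !muln_gt0 ka0 M_gt0.
have [h' ih' rh'] := IH _ bn s' g' ig'.
have [A uA rA] := w_tensor ual.
have uh' i : h' i \in unitmx by apply: iso_unit (ih' i).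
exists (fun i => Phi (A i) (h' i)) => [i|]; first exact: iP.
have PV B X : B \in unitmx -> X \in unitmx ->
    invmx (Phi B X) = Phi (invmx B) (invmx X).
  move=> uB uX; have e1 : Phi B X *m Phi (invmx B) (invmx X) = 1%:M.
    by rewrite -PM ?unitmx_inv // !mulmxV.
  have [uP _] := mulmx1_unit e1.
  by rewrite -[invmx _ in LHS]mulmx1 -e1 mulKmx.
have -> : mxword (fun i => Phi (A i) (h' i)) w = Phi (mxword A w) (mxword h' w).
  elim/last_ind: w => [|u a IHu]; first by rewrite /mxword /= P1.
  rewrite !mxword_rcons IHu PM ?mxword_unit ?mxletter_unit //.
  by congr (_ *m _); rewrite /mxletter; case: a.2; rewrite ?PV.
have uT : al *t 1%:M \in (unitmx : {pred 'M_(d.+1 * M)}).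
  by apply: tensmx_unit; rewrite ?unitmx1 // -lt0n.
have := rP _ _ g' (mxword h' w) uT (mxword_unit w uA).
rewrite -[X in \rank X]opprK opprB mxrank_opp in rA.
have := mxrank_add (g - Phi (al *t 1%:M) g')
  (Phi (al *t 1%:M) g' - Phi (mxword A w) (mxword h' w)).
rewrite addrA subrK.
move: rA rg rh'; set r0 := \rank (al *t _ - _); set r1 := \rank (g - Phi _ _)%R.
set r2 := \rank (g' - _)%R; set r3 := \rank (Phi _ _ - Phi _ _)%R.
set r4 := \rank (g - _)%R.
move=> h1 h2 h3 h4 h5; rewrite en.
have : (r4 <= r1 + ka * r0 + r2)%N by lia.
have : (ka * r0 * (2 * e) <= ka * (d.+1 * M))%N by rewrite -mulnA leq_mul2l h1 orbT.
move: h2 h3; move: (ka * r0)%N (ka * (d.+1 * M))%N => u v; clear.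
by nia.
Qed.

End Splitting.

(** * Independent strings *)

Section Strings.
Variables (F : finFieldType) (n : nat).
Implicit Type g : 'M[F]_n.+1.

Definition power_comb g d (u : 'rV[F]_d) : 'M[F]_n.+1 :=
  \sum_(i < d) u 0 i *: g ^+ i.

Lemma power_combE g d (u : 'rV[F]_d) : power_comb g u = horner_mx g (rVpoly u).
Proof.
rewrite horner_rVpoly /power_comb mulmx_sum_row linear_sum; apply: eq_bigr => i _.
by rewrite linearZ /= rowK mxvecK.
Qed.

(* The bad vectors lie in fewer than #|F| ^ d subspaces of codimension d in K.   *)
Lemma good_vector g d k m (K : 'M[F]_(k, n.+1)) (W : 'M[F]_(m, n.+1)) :
  (forall u : 'rV[F]_d, u != 0 ->
     (n.+1 + d + \rank W <= \rank K + \rank (power_comb g u))%N) ->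
  exists2 v : 'rV[F]_n.+1, (v <= K)%MS &
    forall u : 'rV[F]_d, u != 0 -> ~~ (v *m power_comb g u <= W)%MS.
Proof.
move=> large.
pose bad (u : 'rV[F]_d) := rowg (kermx (power_comb g u *m cokermx W)).
have badP u v : (v \in bad u) = (v *m power_comb g u <= W)%MS.
  by rewrite inE sub_kermx mulmxA submxE.
case: (pickP [pred v | (v \in rowg K) &&
    [forall u : 'rV[F]_d, (u != 0) ==> (v \notin bad u)]]) => [v|none].
  move=> /= /andP[vK /forallP vb]; exists v; first by rewrite inE in vK.
  by move=> u u0; rewrite -badP; apply: implyP (vb u) u0.
have q1 : (1 < #|F|)%N by apply: card_finNzRing_gt1.
have [d0|d0] := posnP d.
  have u0 (u : 'rV[F]_d) : u = 0 by apply/rowP => i; have := ltn_ord i; rewrite {2}d0.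
  move: (none 0); rewrite /= mem_rowg sub0mx /= => /negP[].
  by apply/forallP => u; rewrite [u]u0 eqxx.
have cover : rowg K \subset \bigcup_(u | u != 0) bad u.
  apply/subsetP => v vK; move: (none v) => /=; rewrite vK /=.
  move=> /negbT; rewrite negb_forall => /existsP[u].
  by rewrite negb_imply negbK => /andP[u0 vu]; apply/bigcupP; exists u.
have card_bad u : u != 0 -> (#|bad u| <= #|F| ^ (\rank K - d))%N.
  move=> /large lu; rewrite card_rowg leq_exp2l // mxrank_ker.
  have := mxrank_mul_min (power_comb g u) (cokermx W); rewrite mxrank_coker.
  have := rank_leq_col W; have := rank_leq_row (power_comb g u).
  have := rank_leq_row (power_comb g u *m cokermx W).
  have := rank_leq_col K; move: lu.
  by move: (\rank _) (\rank _) (\rank _) (\rank _) => a b c e; lia.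
have [u0 u0P] : exists u : 'rV[F]_d, u != 0.
  exists (const_mx 1); apply/eqP => /matrixP /(_ 0 (Ordinal d0)) /eqP.
  by rewrite !mxE oner_eq0.
have dK : (d <= \rank K)%N.
  by have := large _ u0P; have := rank_leq_row (power_comb g u0); lia.
have : (#|rowg K| <= \sum_(u : 'rV[F]_d | u != 0%R) #|bad u|)%N.
  apply: leq_trans (subset_leq_card cover) _.
  elim/big_rec2: _ => [|u c A _ le_c]; first by rewrite cards0.
  by apply: leq_trans (leq_card_setU _ _) _; rewrite leq_add2l.
rewrite card_rowg leqNgt => /negP[].
apply: leq_ltn_trans (_ : \sum_(u : 'rV[F]_d | u != 0%R) #|F| ^ (\rank K - d) < _)%N.
  by apply: leq_sum => u /card_bad.
rewrite sum_nat_const -{2}(subnKC dK) expnD ltn_mul2r expn_gt0 ltnW //=.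
have -> : #|[pred u : 'rV[F]_d | u != 0]| = (#|F| ^ d).-1.
  have := cardC1 (0 : 'rV[F]_d); rewrite card_mx mul1n => <-.
  by apply: eq_card => u.
by rewrite prednK ?expn_gt0 // ltnW.
Qed.

Definition string_comb g d t (x : 'M[F]_(t, n.+1)) (U : 'M[F]_(d, t)) : 'rV[F]_n.+1 :=
  \sum_(i < d) row i U *m x *m g ^+ i.

(** [U] lists the coefficients of a combination of the [d * t] rows of [x, x g, .., x g^(d-1)];
    these rows are thus independent modulo [Y]. *)
Definition indep_strings g d t m (x : 'M[F]_(t, n.+1)) (Y : 'M[F]_(m, n.+1)) :=
  forall U : 'M[F]_(d, t), (string_comb g x U <= Y)%MS -> U = 0.

(** Strings are added one at a time, by [good_vector] modulo [Y] and the span of those already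
    found, which has rank at most [t * d] over [Y]. *)
Lemma exists_strings g d t k m (K : 'M[F]_(k, n.+1)) (Y : 'M[F]_(m, n.+1)) :
  (forall u : 'rV[F]_d, u != 0 ->
     (n.+1 + d + \rank Y + t * d <= \rank K + \rank (power_comb g u))%N) ->
  exists2 x : 'M[F]_(t, n.+1), (x <= K)%MS & indep_strings g d x Y.
Proof.
elim: t => [|t IH] large.
  by exists 0; [apply: sub0mx | move=> U _; apply/matrixP => i []].
have [u u0|x xK indx] := IH.
  by apply: leq_trans (large u u0); rewrite leq_add2l leq_mul2r leqnSn orbT.
pose W := (Y + \sum_(i < d) <<x *m (g ^+ i)%R>>)%MS.
have rW : (\rank W <= \rank Y + t * d)%N.
  apply: leq_trans (mxrank_adds_leqif _ _).1 _; rewrite leq_add2l.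
  apply: leq_trans (_ : \sum_(i < d) t <= _)%N.
    apply: (big_ind2 (fun A m => (\rank A <= m)%N)) => [|A a B b hA hB|i _].
    - by rewrite mxrank0.
    - by apply: leq_trans (mxrank_adds_leqif _ _).1 _; apply: leq_add.
    - by rewrite mxrank_gen; apply: leq_trans (mxrankM_maxl _ _) (rank_leq_row _).
  by rewrite sum_nat_const card_ord mulnC.
have [u u0|v vK vW] := @good_vector g d _ _ K W.
  apply: leq_trans (large u u0); move: rW; rewrite mulSn; lia.
exists (col_mx v x : 'M_(1 + t, n.+1)); first by have := col_mx_sub v x K; rewrite vK xK.
move=> U; pose u := (lsubmx (U : 'M_(d, 1 + t)))^T; pose U' := rsubmx (U : 'M_(d, 1 + t)).
have -> : string_comb g (col_mx v x : 'M_(1 + t, n.+1)) U =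
    v *m power_comb g u + string_comb g x U'.
  rewrite /string_comb /power_comb mulmx_sumr -big_split; apply: eq_bigr => i _ /=.
  have -> : row i U = row_mx (u 0 i)%:M (row i U').
    apply/rowP => j; rewrite !mxE; case: splitP => l el; rewrite !mxE.
      rewrite [l]ord1 eqxx mulr1n; congr (U _ _); apply: val_inj.
      by rewrite /= el [l]ord1.
    by congr (U _ _); apply: val_inj; rewrite /= el.
  by rewrite mul_row_col mulmxDl mul_scalar_mx -scalemxAl scalemxAr.
have xW : (string_comb g x U' <= W)%MS.
  apply: submx_trans (addsmxSr _ _); apply: summx_sub => i _.
  apply: submx_trans (_ : x *m g ^+ i <= _)%MS; first by rewrite -mulmxA submxMl.
  by apply: (sumsmx_sup i); rewrite ?genmxE.
move=> UY; have u0 : u = 0.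
  apply: contraTeq UY => /vW; apply: contra => vxY.
  rewrite -[v *m _](addrK (string_comb g x U')) addmx_sub //.
    by apply: submx_trans vxY (addsmxSl _ _).
  by rewrite eqmx_opp.
move: UY; rewrite u0 /power_comb.
rewrite big1 => [|i _]; last by rewrite mxE scale0r.
rewrite mulmx0 add0r => /indx U'0.
rewrite -[LHS](@hsubmxK _ d 1 t) -/U' U'0 -[lsubmx _]trmxK -/u u0.
by rewrite trmx0 row_mx0.
Qed.

Lemma indep_strings_mul g d s t m (A : 'M[F]_(s, t)) (x : 'M[F]_(t, n.+1))
    (Y : 'M[F]_(m, n.+1)) :
  row_free A -> indep_strings g d x Y -> indep_strings g d (A *m x) Y.
Proof.
move=> fA indx U; have -> : string_comb g (A *m x) U = string_comb g x (U *m A).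
  by apply: eq_bigr => i _; rewrite row_mul !mulmxA.
by move=> /indx /eqP; rewrite -(mul0mx _ A) (inj_eq (row_free_inj fA)) => /eqP.
Qed.

End Strings.

(** * Conjugate transposes, stacked strings and dual families *)

Section Adjoint.
Variables (F : fieldType) (sg : {rmorphism F -> F}).

Definition sadj m n (A : 'M[F]_(m, n)) : 'M[F]_(n, m) := map_mx sg A^T.

Lemma sadjM m n p (A : 'M[F]_(m, n)) (B : 'M[F]_(n, p)) :
  sadj (A *m B) = sadj B *m sadj A.
Proof. by rewrite /sadj trmx_mul map_mxM. Qed.

Lemma sadjD m n (A B : 'M[F]_(m, n)) : sadj (A + B) = sadj A + sadj B.
Proof. by rewrite /sadj linearD map_mxD. Qed.

Lemma sadjB m n (A B : 'M[F]_(m, n)) : sadj (A - B) = sadj A - sadj B.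
Proof. by rewrite /sadj linearB map_mxB. Qed.

Lemma sadjZ m n c (A : 'M[F]_(m, n)) : sadj (c *: A) = sg c *: sadj A.
Proof. by rewrite /sadj linearZ map_mxZ. Qed.

Lemma sadj0 m n : sadj (0 : 'M[F]_(m, n)) = 0.
Proof. by rewrite /sadj trmx0 map_mx0. Qed.

Lemma sadj_scalar n c : sadj (c%:M : 'M[F]_n) = (sg c)%:M.
Proof. by rewrite /sadj tr_scalar_mx map_scalar_mx. Qed.

Lemma sadj1 n : sadj (1%:M : 'M[F]_n) = 1%:M.
Proof. by rewrite sadj_scalar rmorph1. Qed.

Lemma mxrank_sadj m n (A : 'M[F]_(m, n)) : \rank (sadj A) = \rank A.
Proof. by rewrite mxrank_map mxrank_tr. Qed.

Lemma sadj_unit n (A : 'M[F]_n) : (sadj A \in unitmx) = (A \in unitmx).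
Proof. by rewrite map_unitmx unitmx_tr. Qed.

Hypothesis sgK : involutive sg.

Lemma sadjK m n (A : 'M[F]_(m, n)) : sadj (sadj A) = A.
Proof. by apply/matrixP => i j; rewrite !mxE sgK. Qed.

End Adjoint.

Section Stack.
Variables (F : fieldType).

Definition stack d t n (f : 'I_d -> 'M[F]_(t, n)) : 'M[F]_(d * t, n) :=
  \matrix_(p, j) f (mxtens_unindex p).1 (mxtens_unindex p).2 j.

Definition block_row d t (i : 'I_d) : 'M[F]_(t, d * t) :=
  \matrix_(j, p) (p == mxtens_index (i, j))%:R.

Lemma stackE d t n (f : 'I_d -> 'M[F]_(t, n)) i j k :
  stack f (mxtens_index (i, j)) k = f i j k.
Proof. by rewrite mxE mxtens_indexK. Qed.

Lemma stack_mulmx d t n p (f : 'I_d -> 'M[F]_(t, n)) (A : 'M[F]_(n, p)) :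
  stack f *m A = stack (fun i => f i *m A).
Proof. by apply/matrixP => i j; rewrite !mxE; apply: eq_bigr => k _; rewrite mxE. Qed.

Lemma eq_stack d t n (f f' : 'I_d -> 'M[F]_(t, n)) :
  f =1 f' -> stack f = stack f'.
Proof. by move=> ef; apply/matrixP => i j; rewrite !mxE ef. Qed.

Lemma sum_mxtens d t (f : 'I_(d * t) -> F) :
  \sum_p f p = \sum_(i < d) \sum_(j < t) f (mxtens_index (i, j)).
Proof.
rewrite pair_big /= (reindex (@mxtens_index d t)) /=.
  by apply: eq_bigr => -[].
by exists (@mxtens_unindex d t) => i _; rewrite ?mxtens_indexK ?mxtens_unindexK.
Qed.

Lemma block_row_stack d t n (f : 'I_d -> 'M[F]_(t, n)) i :
  block_row t i *m stack f = f i.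
Proof.
apply/matrixP => j k; rewrite mxE (bigD1 (mxtens_index (i, j))) //= stackE.
rewrite mxE eqxx mul1r big1 ?addr0 // => p pij.
by rewrite mxE (negPf pij) mul0r.
Qed.

Lemma tens_stack d e t n (A : 'M[F]_(e, d)) (f : 'I_d -> 'M[F]_(t, n)) :
  (A *t 1%:M) *m stack f = stack (fun i => \sum_(k < d) A i k *: f k).
Proof.
apply/matrixP => p k; case: (mxtens_indexP p) => i j; rewrite stackE summxE mxE sum_mxtens.
apply: eq_bigr => l _; rewrite (bigD1 j) //= tensmxE stackE mxE eqxx mulr1 mxE.
rewrite big1 ?addr0 // => j' j'j.
by rewrite tensmxE mxE eq_sym (negPf j'j) mulr0 mul0r.
Qed.

Lemma mul_row_stack d t n (u : 'rV[F]_(d * t)) (f : 'I_d -> 'M[F]_(t, n)) :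
  u *m stack f =
  \sum_(i < d) row i (\matrix_(i, j) u 0 (mxtens_index (i, j))) *m f i.
Proof.
apply/rowP => k; rewrite summxE mxE sum_mxtens; apply: eq_bigr => i _.
by rewrite mxE; apply: eq_bigr => j _; rewrite stackE !mxE.
Qed.

Variable sg : {rmorphism F -> F}.

Lemma stack_pairE d e t u n (f : 'I_d -> 'M[F]_(t, n)) (h : 'I_e -> 'M[F]_(u, n)) J i j k l :
  (stack f *m J *m sadj sg (stack h)) (mxtens_index (i, j)) (mxtens_index (k, l)) =
  (f i *m J *m sadj sg (h k)) j l.
Proof.
rewrite stack_mulmx !mxE; apply: eq_bigr => m _.
by rewrite stackE !mxE mxtens_indexK.
Qed.

Lemma stack_pair0 d e t u n (f : 'I_d -> 'M[F]_(t, n)) (h : 'I_e -> 'M[F]_(u, n)) J :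
  (forall i k, f i *m J *m sadj sg (h k) = 0) ->
  stack f *m J *m sadj sg (stack h) = 0.
Proof.
move=> fh; apply/matrixP => p q; case: (mxtens_indexP p) => i j.
by case: (mxtens_indexP q) => k l; rewrite stack_pairE fh !mxE.
Qed.

Lemma stack_pair1 d t n (f h : 'I_d -> 'M[F]_(t, n)) J :
  (forall i k, f i *m J *m sadj sg (h k) = (i == k)%:R%:M) ->
  stack f *m J *m sadj sg (stack h) = 1%:M.
Proof.
move=> fh; apply/matrixP => p q; case: (mxtens_indexP p) => i j.
case: (mxtens_indexP q) => k l; rewrite stack_pairE fh !mxE.
rewrite (inj_eq (can_inj (@mxtens_indexK _ _))) xpair_eqE.
by case: (i == k); case: (j == l); rewrite ?mul0rn.
Qed.

Lemma stack_pair_unit d t n (f h : 'I_d -> 'M[F]_(t, n)) J :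
  (forall i k : 'I_d, (i <= k)%N -> f i *m J *m sadj sg (h k) = (i == k)%:R%:M) ->
  stack f *m J *m sadj sg (stack h) \in unitmx.
Proof.
move=> fh; set N := _ *m _.
have Ntrig : is_trig_mx N.
  apply/is_trig_mxP => p q; case: (mxtens_indexP p) => i j.
  case: (mxtens_indexP q) => k l /= lt; rewrite stack_pairE fh.
    rewrite !mxE; case: (i =P k) => [ik|_]; last by rewrite mul0rn.
    rewrite [j == l](_ : _ = false) //; apply/eqP => jl.
    by move: lt; rewrite ik jl ltnn.
  rewrite leqNgt; apply/negP => ki; move: lt; rewrite ltnNge => /negP[].
  apply: leq_trans (_ : k.+1 * t <= _)%N; first by rewrite mulSn addnC leq_add2r ltnW.
  by apply: leq_trans (leq_addr _ _); rewrite leq_mul2r ki orbT.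
rewrite unitmxE det_trig // big1 ?unitr1 // => p _; case: (mxtens_indexP p) => i j.
by rewrite stack_pairE fh // eqxx mxE eqxx.
Qed.

End Stack.

Section Duals.
Variables (F : finFieldType) (n : nat) (sg : {rmorphism F -> F}).
Hypothesis sgK : involutive sg.
Variables (J g k : 'M[F]_n.+1).

(** By hypothesis the rows [x g^i] stay independent as functionals on [K], so a right inverse of
    their matrix solves the pairing equations inside [K]. *)
Lemma exists_dual d t m (x : 'M[F]_(t, n.+1)) (K : 'M[F]_(m, n.+1)) (o : nat) :
  indep_strings g d x (kermx (J *m sadj sg K)) ->
  exists2 z : 'M[F]_(t, n.+1), (z <= K)%MS &
  forall i, (i < d)%N -> x *m g ^+ i *m J *m sadj sg z = (i == o)%:R%:M.
Proof.
move=> indx; pose E := stack (fun i : 'I_d => x *m g ^+ i).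
have /row_freeP[X EX] : row_free (E *m (J *m sadj sg K)).
  rewrite -kermx_eq0 -submx0; apply/row_subP => p; set u := row _ _.
  have : (u <= kermx (E *m (J *m sadj sg K)))%MS by apply: row_sub.
  rewrite sub_kermx mulmxA -sub_kermx mul_row_stack => uE.
  have := indx (\matrix_(i, j) u 0 (mxtens_index (i, j))) _.
  rewrite /string_comb (eq_bigr _ (fun i _ => esym (mulmxA _ _ _))) => /(_ uE) u0.
  suff -> : u = 0 by apply: sub0mx.
  apply/rowP => q; case: (mxtens_indexP q) => i j; rewrite [RHS]mxE.
  by move/matrixP: u0 => /(_ i j); rewrite !mxE.
have [od|od] := ltnP o d; last first.
  exists 0; first exact: sub0mx.
  move=> i id; rewrite sadj0 mulmx0 ltn_eqF ?(leq_trans id) //.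
  by apply/matrixP => a b; rewrite !mxE mul0rn.
pose S : 'M[F]_(d * t, t) := (block_row F t (Ordinal od))^T.
exists (sadj sg (sadj sg K *m X *m S)).
  by rewrite !sadjM (sadjK sgK) mulmxA submxMl.
move=> i id; rewrite (sadjK sgK).
rewrite -[x *m g ^+ i](block_row_stack (fun i : 'I_d => x *m g ^+ i) (Ordinal id)) -/E.
rewrite -!mulmxA [E *m _]mulmxA [E *m J *m _]mulmxA -[E *m J *m _]mulmxA.
rewrite [E *m _ *m _]mulmxA EX mul1mx.
apply/matrixP => a b; rewrite mxE (bigD1 (mxtens_index (Ordinal id, a))) //=.
rewrite !mxE eqxx mul1r big1 ?addr0 => [|p pa]; last by rewrite mxE (negPf pa) mul0r.
rewrite (inj_eq (can_inj (@mxtens_indexK _ _))) xpair_eqE -val_eqE /=.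
by case: (i == o); rewrite ?mul0rn.
Qed.

End Duals.

(** * Polynomials of small rank against long free strings *)

Section Dichotomy.
Variables (F : finFieldType) (n : nat).

(** Take the least degree [d] in which some polynomial falls below its threshold. It is positive,
    since nonzero constants have full rank, and nonzero combinations of fewer powers have smaller
    degree, hence large rank. *)
Lemma rank_dichotomy (g : 'M[F]_n.+1) (L : nat) (rho : nat -> nat) :
  (forall a b, (a <= b)%N -> (rho b <= rho a)%N) -> (rho 0%N < n.+1)%N ->
  (exists d (f : {poly F}), [/\ (0 < d < L)%N, size f = d.+1,
     (\rank (horner_mx g f) <= rho d)%N &
     forall u : 'rV[F]_d, u != 0 -> (rho d.-1 < \rank (power_comb g u))%N])
  \/ (forall u : 'rV[F]_L, u != 0 -> (rho L < \rank (power_comb g u))%N).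
Proof.
move=> rho_le rho0.
pose P d := (d < L)%N && [exists u : 'rV[F]_d.+1,
  (size (rVpoly u) == d.+1) && (\rank (horner_mx g (rVpoly u)) <= rho d)%N].
have notP e d (u : 'rV[F]_d) : (e < L)%N -> ~~ P e -> size (rVpoly u) = e.+1 ->
    (rho e < \rank (power_comb g u))%N.
  move=> eL; rewrite /P eL negb_exists => /forallP /(_ (poly_rV (rVpoly u))) + sz.
  by rewrite poly_rV_K ?sz // eqxx /= -ltnNge power_combE.
have size_u d (u : 'rV[F]_d) : u != 0 ->
    exists2 e, (e < d)%N & size (rVpoly u) = e.+1.
  move=> u0; have : rVpoly u != 0.
    by apply: contraNneq u0 => p0; rewrite -[u]rVpolyK p0 linear0.
  rewrite -size_poly_eq0; case E: (size _) => [|e] // _.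
  by exists e => //; rewrite -E size_poly.
case: (boolp.pselect (exists d, P d)) => [exP|noP].
  left; case: (ex_minnP exP) => d /andP[dL /existsP[u /andP[/eqP su ru]]] dmin.
  exists d, (rVpoly u); split=> //.
    rewrite dL andbT lt0n; apply: contraTneq ru => d0.
    have [c c0 ->] : exists2 c, c != 0 & rVpoly u = c%:P.
      have /size_poly1P[c c0 ->] : size (rVpoly u) == 1%N by rewrite su d0.
      by exists c.
    rewrite d0 horner_mx_C -ltnNge mxrank_unit //.
    by rewrite unitmxE det_scalar unitfE expf_neq0.
  move=> v v0; have [e ed se] := size_u _ _ v0.
  apply: leq_ltn_trans (notP e _ _ _ _ se); last 1 first.
  - by apply/negP => /dmin; rewrite leqNgt ed.
  - by apply: rho_le; rewrite -ltnS prednK // (leq_ltn_trans _ ed).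
  - by apply: ltn_trans dL.
right=> u u0; have [e eL se] := size_u _ _ u0.
apply: leq_ltn_trans (notP e _ _ eL _ se); first by apply: rho_le; apply: ltnW.
by apply/negP => Pe; apply: noP; exists e.
Qed.

Variable sg : {rmorphism F -> F}.
Hypothesis sgK : involutive sg.
Variables (J g k : 'M[F]_n.+1).
(** [k] is an adjoint of [g] for [J]: the transpose when [J] is [1], the inverse when [g] is an
    isometry. *)
Hypothesis adj_gk : g *m J = J *m sadj sg k.

Lemma horner_adjoint (f : {poly F}) :
  horner_mx g f *m J = J *m sadj sg (horner_mx k (map_poly sg f)).
Proof.
elim/poly_ind: f => [|f c IH]; first by rewrite !rmorph0 mul0mx sadj0 mulmx0.
rewrite [in RHS]mulrC !rmorphD !rmorphM /= map_polyX map_polyC /= !horner_mx_C !horner_mx_X.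
rewrite sadjD -!/(_ *m _) mulmxDl mulmxDr sadjM sadj_scalar sgK scalar_mxC; congr (_ + _).
by rewrite -[LHS]mulmxA adj_gk !mulmxA IH.
Qed.

Lemma adjoint_exp i : g ^+ i *m J = J *m sadj sg (k ^+ i).
Proof.
elim: i => [|i IH]; first by rewrite !expr0 mul1mx sadj1 mulmx1.
by rewrite exprSr exprS -[_ * g]/(_ *m g) -mulmxA adj_gk mulmxA IH -mulmxA -sadjM.
Qed.

Hypothesis rankJ : (n.+1 <= \rank J + 6)%N.

(* The threshold rho d on the rank of f(g), deg f = d, shrinks by a factor 3 at *)
(* each degree: for the least d where some f(g) is below it, all polynomials of *)
(* degree < d still have large rank on ker f(g) and modulo its orthogonal.      *)
Lemma exists_string_family t D :
  (3 ^ (2 * D).+1 * (t.+1 * (2 * D).+1 + 12) < n.+1)%N ->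
  exists d (K : 'M[F]_n.+1) (x : 'M[F]_(t, n.+1)),
  [/\ (0 < d <= (2 * D).+1)%N, indep_strings g d x (kermx (J *m sadj sg K)) &
    (exists f : {poly F}, [/\ size f = d.+1, x *m horner_mx g f = 0 &
       forall m (v : 'M[F]_(m, n.+1)), (v <= K)%MS ->
         v *m horner_mx k (map_poly sg f) = 0])
    \/ d = (2 * D).+1].
Proof.
set L := (2 * D).+1; set theta := (_ * L + 12)%N => large.
pose rho d := (3 ^ (L - d) * theta)%N.
have rho_le a b : (a <= b)%N -> (rho b <= rho a)%N.
  by move=> ab; rewrite leq_mul2r leq_exp2l // leq_sub2l ?orbT.
have rho_theta d : (theta <= rho d)%N by rewrite leq_pmull ?expn_gt0.
have rho0 : (rho 0%N < n.+1)%N by rewrite /rho subn0.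
case: (@rank_dichotomy g L rho rho_le rho0) => [[d [f [/andP[d0 dL] sf rf rd]]]|rL].
  pose K' := kermx (horner_mx k (map_poly sg f)).
  exists d, K'.
  have rhoS : (3 * rho d <= rho d.-1)%N.
    by rewrite /rho mulnA -expnS leq_mul2r leq_exp2l // orbC; case: (d) d0 dL => // d' _; lia.
  have [|x xK indx] := @exists_strings _ _ g d t _ _
      (kermx (horner_mx g f)) (kermx (J *m sadj sg K')).
    move=> u /rd ru; rewrite !mxrank_ker.
    have h1 := mxrank_mul_min J (sadj sg K').
    rewrite mxrank_sadj mxrank_ker in h1.
    have h2 := mxrank_mul_min J (sadj sg (horner_mx k (map_poly sg f))).
    rewrite -horner_adjoint mxrank_sadj in h2.
    have h3 := leq_trans (mxrankM_maxl (horner_mx g f) J) rf.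
    have h4 : ((t * d + d) + 12 <= theta)%N.
      by rewrite /theta leq_add2r -mulSnr leq_mul2l ltnW ?orbT.
    have h5 := rank_leq_row J.
    have h6 := rank_leq_row (horner_mx k (map_poly sg f)).
    have h7 := rho_theta d.
    have h8 := rho_le _ _ (leq0n d.-1).
    move: h1 h2 h3 h4 h5 h6 h7 h8 ru rhoS rf rho0 rankJ.
    move: (\rank _) (\rank _) (\rank _) (\rank _) (\rank _) (\rank _).
    clear; move: (rho d) (rho d.-1) (rho 0%N) (t * d)%N => a b c e.
    by lia.
  exists x; split=> //; first by rewrite d0 ltnW.
  left; exists f; split=> //; first by apply/sub_kermxP.
  by move=> m v vK; apply/sub_kermxP.
have [|x _ indx] := @exists_strings _ _ g L t _ _ 1%:M (kermx (J *m sadj sg (1%:M : 'M_n.+1))).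
  move=> u /rL ru; rewrite mxrank1 mxrank_ker sadj1 mulmx1.
  have h7 := rho_theta L.
  have h4 : ((t * L + L) + 12 <= theta)%N by rewrite /theta -mulSnr.
  move: h7 h4 ru rankJ; clear; move: (t * L)%N (rho L) (\rank _) (\rank _) => a b c e.
  by lia.
by exists L, 1%:M, x; split; rewrite ?leqnn //; right.
Qed.

End Dichotomy.

(** * Closing the strings *)

Lemma sadj_tens1 (F : fieldType) (sg : {rmorphism F -> F}) d M (al : 'M[F]_d) :
  sadj sg (al *t (1%:M : 'M_M)) = sadj sg al *t 1%:M.
Proof. by rewrite /sadj trmx_tens map_mxT trmx1 map_mx1. Qed.

Lemma tens1_unit (F : fieldType) d M (al : 'M[F]_d) :
  (0 < M)%N -> al *t (1%:M : 'M_M) \in unitmx -> al \in unitmx.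
Proof.
move=> M0; rewrite -!row_free_unit -!kermx_eq0 -!submx0 => ker0.
apply/row_subP => i; set u := row _ _.
have u0 : u *m al = 0 by apply/sub_kermxP; apply: row_sub.
pose v : 'M[F]_(1 * M, d * M) := u *t 1%:M.
have : (v <= kermx (al *t 1%:M))%MS.
  by apply/sub_kermxP; rewrite /v tensmx_mul u0 tens0mx.
move=> /submx_trans /(_ ker0); rewrite submx0 => /eqP /matrixP v0.
suff -> : u = 0 by apply: sub0mx.
apply/rowP => j; have := v0 (mxtens_index (0, Ordinal M0)) (mxtens_index (j, Ordinal M0)).
by rewrite tensmxE !mxE eqxx mulr1.
Qed.

Section Closing.
Variables (F : finFieldType) (n : nat) (sg : {rmorphism F -> F}).
Hypothesis sgK : involutive sg.
Variables (J g k : 'M[F]_n.+1).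
Hypothesis adj_gk : g *m J = J *m sadj sg k.
Variable M : nat.

Lemma horner_recurrence (h : 'M[F]_n.+1) (f : {poly F}) d m (v : 'M[F]_(m, n.+1)) :
  size f = d.+2 -> v *m horner_mx h f = 0 ->
  v *m h ^+ d.+1 = \sum_(i < d.+1) (- (f`_i / f`_d.+1)) *: (v *m h ^+ i).
Proof.
move=> sf vf; have f0 : f`_d.+1 != 0.
  by rewrite -[d.+1]/(d.+2.-1) -sf -lead_coefE lead_coef_eq0 -size_poly_eq0 sf.
have ef : horner_mx h f = \sum_(i < d.+2) f`_i *: h ^+ i.
  rewrite -{1}[f](@poly_rV_K _ d.+2) ?sf // -power_combE.
  by apply: eq_bigr => i _; rewrite mxE.
move: vf; rewrite ef big_ord_recr /= mulmxDr mulmx_sumr -scalemxAr => /eqP.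
rewrite addrC addr_eq0 => /eqP/(congr1 (fun A => (f`_d.+1)^-1 *: A)).
rewrite scalerA mulVf // scale1r => ->; rewrite scalerN scaler_sumr -sumrN.
by apply: eq_bigr => i _; rewrite -scalemxAr scalerA scaleNr mulrC.
Qed.

Lemma pairing_exp m m' (x : 'M[F]_(m, n.+1)) (z : 'M[F]_(m', n.+1)) i j :
  x *m g ^+ i *m J *m sadj sg (z *m k ^+ j) = x *m g ^+ (i + j) *m J *m sadj sg z.
Proof.
rewrite sadjM exprD -[g ^+ i * _]/(g ^+ i *m _) -!mulmxA; do 2 congr (_ *m _).
by rewrite !mulmxA -(adjoint_exp adj_gk).
Qed.

(** The recurrence given by [f] makes both strings invariant, [g] acting on the first by the
    companion matrix [al]. In the reversed order chosen for the powers of [k] the Gram matrix is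
    triangular with unit diagonal, so [B] can turn the second string into the exact dual basis, on
    which [k] has to act by the adjoint. *)
Lemma close_polynomial d (f : {poly F}) (x z : 'M[F]_(M, n.+1)) :
  (0 < M)%N -> g \in unitmx ->
  size f = d.+2 -> x *m horner_mx g f = 0 -> z *m horner_mx k (map_poly sg f) = 0 ->
  (forall i, (i < d.+1)%N -> x *m g ^+ i *m J *m sadj sg z = (i == d)%:R%:M) ->
  let E := stack (fun i : 'I_d.+1 => x *m g ^+ i) in
  exists (al : 'M[F]_d.+1) (B : 'M[F]_(d.+1 * M)),
  let E' := B *m stack (fun i : 'I_d.+1 => z *m k ^+ (d - i)) in
  [/\ al \in unitmx, E *m J *m sadj sg E' = 1%:M, E *m g = (al *t 1%:M) *m E &
      E' *m k = sadj sg (al *t 1%:M) *m E'].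
Proof.
move=> M0 ug sf xf zf xz E.
pose E0 := stack (fun i : 'I_d.+1 => z *m k ^+ (d - i)).
have uN : E *m J *m sadj sg E0 \in unitmx.
  apply: stack_pair_unit => i j ij; rewrite pairing_exp xz; last by have := ltn_ord j; lia.
  by rewrite -val_eqE /=; congr (_%:R%:M); have := ltn_ord j; lia.
pose al : 'M[F]_d.+1 := \matrix_(i, j)
  if (i < d)%N then (j == i.+1 :> nat)%:R else - (f`_j / f`_d.+1).
have Eg : E *m g = (al *t 1%:M) *m E.
  rewrite stack_mulmx tens_stack; apply: eq_stack => i.
  rewrite -mulmxA -[g ^+ i *m g]/(g ^+ i * g) -exprSr.
  have [id|di] := ltnP i d.
    have i1d : (i.+1 < d.+1)%N by [].
    rewrite (bigD1 (Ordinal i1d)) //= mxE id eqxx scale1r big1 ?addr0 // => j ji.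
    by rewrite mxE id; move: ji; rewrite -val_eqE /= => /negPf->; rewrite scale0r.
  have -> : i = d :> nat by apply/eqP; rewrite eqn_leq di -ltnS ltn_ord.
  rewrite (horner_recurrence sf xf); apply: eq_bigr => j _.
  by rewrite mxE ltnNge di.
have [be E0k] : exists be : 'M[F]_d.+1, E0 *m k = (be *t 1%:M) *m E0.
  have sf' : size (map_poly sg f) = d.+2 by rewrite size_map_poly.
  exists (\matrix_(i, j) if (0 < i)%N then (j == i.-1 :> nat)%:R
    else - ((map_poly sg f)`_(d - j) / (map_poly sg f)`_d.+1)).
  rewrite stack_mulmx tens_stack; apply: eq_stack => i.
  rewrite -mulmxA -[k ^+ _ *m k]/(k ^+ _ * k) -exprSr.
  have [i0|i0] := posnP i.
    rewrite i0 subn0 (horner_recurrence sf' zf) (reindex_inj rev_ord_inj) /=.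
    by apply: eq_bigr => j _; rewrite mxE i0 /= subSS.
  have i1d : (i.-1 < d.+1)%N by have := ltn_ord i; lia.
  rewrite (bigD1 (Ordinal i1d)) //= mxE i0 eqxx scale1r big1 ?addr0 => [|j ji].
    by congr (_ *m _ ^+ _); have := ltn_ord i; lia.
  by rewrite mxE i0; move: ji; rewrite -val_eqE /= => /negPf->; rewrite scale0r.
pose B := sadj sg (invmx (E *m J *m sadj sg E0)).
exists al, B => E'.
have EE' : E *m J *m sadj sg E' = 1%:M.
  by rewrite sadjM (sadjK sgK) mulmxA mulmxV.
have freeE : row_free E by apply/row_freeP; exists (J *m sadj sg E'); rewrite mulmxA.
have uA : al *t (1%:M : 'M_M) \in unitmx.
  rewrite -row_full_unit -[row_full _]/(\rank _ == _) eqn_leq rank_leq_row /=.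
  apply: leq_trans (mxrankM_maxl _ E); rewrite -Eg mxrankMfree ?row_free_unit //.
  by rewrite (eqP freeE).
split=> //; first exact: tens1_unit uA.
have uB : B \in unitmx by rewrite sadj_unit unitmx_inv.
have E'k : E' *m k = (B *m (be *t 1%:M) *m invmx B) *m E'.
  by rewrite /E' -mulmxA E0k !mulmxA mulmxKV.
have e1 : E *m g *m J *m sadj sg E' = al *t 1%:M.
  by rewrite Eg -(mulmxA _ E) -(mulmxA _ (E *m J)) EE' mulmx1.
have e2 : E *m g *m J *m sadj sg E' =
    E *m J *m sadj sg E' *m sadj sg (B *m (be *t 1%:M) *m invmx B).
  rewrite -(mulmxA _ (sadj sg E')) -sadjM -E'k [sadj sg (E' *m k)]sadjM.
  by rewrite [RHS]mulmxA -(mulmxA E) adj_gk [E *m (_ *m _)]mulmxA.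
by rewrite -e1 e2 EE' mul1mx (sadjK sgK).
Qed.

(* Multiplying g by an involution ta that exchanges y and y g^(D+1), and dually *)
(* z and z k^(D+1), closes the strings y, y g, .., y g^D into cycles.           *)
Section Cyclic.
Variables (D : nat) (y z : 'M[F]_(M, n.+1)).
(** The exponents reach [2 * D.+1] because [y g^(D+1)] gets paired with [z k^(D+1)]. *)
Hypothesis yz : forall i, (i < (2 * D.+1).+1)%N ->
  y *m g ^+ i *m J *m sadj sg z = (i == D.+1)%:R%:M.

Definition cycle_mx : 'M[F]_D.+1 := perm_mx (perm (@ordS_inj D.+1)).

Lemma cycle_mx_unit : cycle_mx \in unitmx.
Proof. exact: unitmx_perm. Qed.

Let E := stack (fun i : 'I_D.+1 => y *m g ^+ i).
Let E' := stack (fun i : 'I_D.+1 => z *m k ^+ (D.+1 - i)).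
Definition cycle_left := y - y *m g ^+ D.+1.
Definition cycle_right := z *m k ^+ D.+1 - z.
Let a := cycle_left.
Let b := cycle_right.

Lemma cycle_dual : E *m J *m sadj sg E' = 1%:M.
Proof.
apply: stack_pair1 => i j; rewrite pairing_exp yz; last first.
  by have := ltn_ord i; have := ltn_ord j; lia.
by congr (_%:R%:M); rewrite -val_eqE /=; have := ltn_ord i; have := ltn_ord j; lia.
Qed.

Lemma pair_cycle_right i : (i <= D.+1)%N ->
  y *m g ^+ i *m J *m sadj sg b = ((i == 0%N)%:R - (i == D.+1)%:R)%:M.
Proof.
move=> iD; rewrite sadjB mulmxBr pairing_exp !yz; try by lia.
by rewrite raddfB /=; congr (_%:R%:M - _); lia.
Qed.

Lemma pair_cycle_left j : (j <= D.+1)%N ->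
  a *m J *m sadj sg (z *m k ^+ (D.+1 - j)) = ((j == 0%N)%:R - (j == D.+1)%:R)%:M.
Proof.
move=> jD; rewrite mulmxBl mulmxBl.
have := pairing_exp y z 0 (D.+1 - j); rewrite expr0 mulmx1 add0n => ->.
rewrite pairing_exp !yz; try by lia.
by rewrite raddfB /=; congr (_%:R%:M - _%:R%:M); lia.
Qed.

Lemma cycle_action_left (ta : 'M[F]_n.+1) :
  (forall i, (i <= D.+1)%N ->
     y *m g ^+ i *m ta = y *m g ^+ i - ((i == 0%N)%:R - (i == D.+1)%:R) *: a) ->
  E *m (g *m ta) = (cycle_mx *t 1%:M) *m E.
Proof.
move=> Hta; rewrite mulmxA !stack_mulmx tens_stack; apply: eq_stack => i.
rewrite -(mulmxA y) -[g ^+ i *m g]/(g ^+ i * g) -exprSr Hta ?ltn_ord //.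
rewrite (bigD1 (ordS i)) //= !mxE permE eqxx scale1r big1 ?addr0 => [|j ji]; last first.
  by rewrite !mxE permE eq_sym (negPf ji) scale0r.
have := ltn_ord i; rewrite ltnS leq_eqVlt => /orP[/eqP->|iD].
  by rewrite eqxx modnn expr0 mulmx1 /a /cycle_left sub0r scaleN1r opprK addrC subrK.
by rewrite modn_small // eqSS ltn_eqF //= subrr scale0r subr0.
Qed.

Lemma cycle_action_right (ta : 'M[F]_n.+1) :
  (forall j, (j <= D)%N ->
     z *m k ^+ (D.+1 - j) *m ta = z *m k ^+ (D.+1 - j) - (j == 0%N)%:R *: b) ->
  E' *m (ta *m k) = sadj sg (cycle_mx *t 1%:M) *m E'.
Proof.
move=> Hta; rewrite sadj_tens1 mulmxA !stack_mulmx tens_stack; apply: eq_stack => j.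
rewrite Hta; last by rewrite -ltnS.
rewrite (bigD1 (ord_pred j)) //= !mxE permE ord_predK eqxx rmorph1 scale1r.
rewrite big1 ?addr0 => [|i ij]; last first.
  rewrite !mxE permE (_ : (ordS i == j) = false) ?rmorph0 ?scale0r //.
  by apply: contraNF ij => /eqP<-; rewrite ordSK.
case: (posnP j) => [->|j0].
  rewrite subn0 scale1r /b /cycle_right opprB addrC subrK add0n modn_small // subSnn.
  by rewrite expr1.
rewrite scale0r subr0 -mulmxA -[_ *m k]/(_ * k) -exprSr.
congr (_ *m _ ^+ _).
have -> : ((j + D.+1).-1 %% D.+1 = j.-1)%N.
  rewrite -{2}(prednK j0) /= addnS /= -{1}(prednK j0) addSnnS modnDr modn_small //.
  by have := ltn_ord j; lia.
by have := ltn_ord j; lia.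
Qed.

End Cyclic.

End Closing.

(** [P *m E] projects onto the row space of [E]; [C] is a basis of the kernel of this projection,
    and [C'] gives the coordinates along [C]. *)
Lemma complement_mx (F : fieldType) r n (E : 'M[F]_(r, n)) (P : 'M[F]_(n, r)) :
  E *m P = 1%:M ->
  exists b (C : 'M[F]_(b, n)) (C' : 'M[F]_(n, b)),
  [/\ n = (r + b)%N, C *m C' = 1%:M, C *m P = 0, E *m C' = 0
    & P *m E + C' *m C = 1%:M].
Proof.
move=> EP; have rP : \rank P = r.
  apply/eqP; rewrite eqn_leq rank_leq_col /=.
  by apply: leq_trans (mxrankM_maxr E P); rewrite EP mxrank1.
pose C := row_base (kermx P).
have CP : C *m P = 0 by apply/sub_kermxP; rewrite eq_row_base.
have /submxP[C' eC'] : (1%:M - P *m E <= C)%MS.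
  rewrite eq_row_base; apply/sub_kermxP.
  by rewrite mulmxBl mul1mx -mulmxA EP mulmx1 subrr.
have freeC : row_free C by apply: row_base_free.
exists (\rank (kermx P)), C, C'; split=> //.
- by rewrite mxrank_ker rP subnKC // -rP rank_leq_row.
- apply: (row_free_inj freeC); rewrite -mulmxA -eC' mulmxBr mulmx1 mulmxA CP.
  by rewrite mul0mx subr0 mul1mx.
- apply: (row_free_inj freeC); rewrite -mulmxA -eC' mulmxBr mulmx1 mulmxA EP.
  by rewrite mul1mx subrr mul0mx.
- by rewrite -eC' addrC subrK.
Qed.

(** * The general linear group *)

Section GL.
Variable F : finFieldType.

Definition GL_iso n (_ : unit) (g : 'M[F]_n) := g \in unitmx.

(** The condition on [P] makes its kernel, a complement of [E], invariant under [g1], which is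
    therefore block diagonal. The block occurs without a dual copy, so [kappa] is [1]. *)
Lemma GL_assemble M D n (g g1 : 'M[F]_n) d (al : 'M[F]_d.+1)
    (E : 'M[F]_(d.+1 * M, n)) (P : 'M[F]_(n, d.+1 * M)) :
  g1 \in unitmx -> al \in unitmx -> E *m P = 1%:M ->
  E *m g1 = (al *t 1%:M) *m E -> g1 *m P = P *m (al *t 1%:M) ->
  (\rank (g - g1)%R * D <= d.+1 * M)%N ->
  splits GL_iso M D tt g.
Proof.
move=> ug1 ual EP Eg gP rg.
have [b [C [C' [en CC' CP EC' PEC]]]] := complement_mx EP.
pose Phi (A : 'M[F]_(d.+1 * M)) (X : 'M[F]_b) := P *m A *m E + C' *m X *m C.
have PhiM A A' X X' : Phi (A *m A') (X *m X') = Phi A X *m Phi A' X'.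
  rewrite /Phi mulmxDl !mulmxDr !mulmxA -(mulmxA _ E P) EP mulmx1.
  rewrite -(mulmxA _ E C') EC' mulmx0 !mul0mx addr0.
  by rewrite -(mulmxA _ C P) CP mulmx0 !mul0mx add0r -(mulmxA _ C C') CC' mulmx1.
have Phi1 : Phi 1%:M 1%:M = 1%:M by rewrite /Phi !mulmx1.
have Phi_unit A X : A \in unitmx -> X \in unitmx -> Phi A X \in unitmx.
  move=> uA uX; have : Phi A X *m Phi (invmx A) (invmx X) = 1%:M.
    by rewrite -PhiM !mulmxV.
  by case/mulmx1_unit.
have eg1 : g1 = Phi (al *t 1%:M) (C *m g1 *m C').
  rewrite -[LHS]mulmx1 -PEC mulmxDr mulmxA gP; congr (_ + _).
  rewrite -[g1 in LHS]mul1mx -{1}PEC mulmxDl mulmxDl -!mulmxA (mulmxA E) Eg.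
  by rewrite -!mulmxA (mulmxA E) EC' mul0mx !mulmx0 add0r !mulmxA.
have ug' : C *m g1 *m C' \in unitmx.
  have e1 : (C *m g1 *m C') *m (C *m invmx g1 *m C') = 1%:M.
    have -> : (C *m g1 *m C') *m (C *m invmx g1 *m C') =
        C *m g1 *m (C' *m C) *m invmx g1 *m C' by rewrite !mulmxA.
    rewrite -[C' *m C](addKr (P *m E)) PEC addrC mulmxBr mulmxBl mulmxBl mulmx1.
    rewrite (mulmxA _ P) -(mulmxA C g1 P) gP (mulmxA C P) CP !mul0mx subr0.
    by rewrite -(mulmxA C g1) mulmxV // mulmx1 CC'.
  by case/mulmx1_unit: e1.
exists b, tt, (C *m g1 *m C'), d, al, 1%N, Phi; split=> //.
- by rewrite mul1n.
- by rewrite -eg1 mul1n.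
- move=> A A' X X' _ _; rewrite mul1n /Phi opprD addrACA -!mulmxBl -!mulmxBr.
  apply: leq_trans (mxrank_add _ _) _; apply: leq_add.
    by apply: leq_trans (mxrankM_maxl _ _) (mxrankM_maxr _ _).
  by apply: leq_trans (mxrankM_maxl _ _) (mxrankM_maxr _ _).
Qed.

(** With [J] equal to [1] and [k] the transpose of [g], the dual strings are linear functionals. In
    the cyclic case [ta] differs from the identity by rank at most [M], against a block of dimension
    [D.+1 * M]. *)
Lemma GL_splits M D n (g : 'M[F]_n) : (0 < M)%N ->
  (3 ^ (2 * D.+1).+1 * (M.+1 * (2 * D.+1).+1 + 12) < n)%N -> g \in unitmx ->
  splits GL_iso M D.+1 tt g.
Proof.
case: n g => // n g M0 large ug.
pose sg := GRing.RMorphism.clone F F idfun _.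
have sgK : involutive sg by [].
have sadj_tr m m' (A : 'M[F]_(m, m')) : sadj sg A = A^T.
  by apply/matrixP => i j; rewrite !mxE.
have adj : g *m 1%:M = 1%:M *m sadj sg g^T by rewrite sadj_tr trmxK mulmx1 mul1mx.
have [|d [K [x [/andP[d0 _] indx]]]] := exists_string_family sgK adj _ large.
  by rewrite mxrank1 leq_addr.
case=> [[f [sf xf Kf]]|dL].
  case: d d0 indx sf => // d _ indx sf.
  have [z zK xz] := exists_dual sgK d indx.
  have [al [B /= [ual EE' Eg E'k]]] := close_polynomial sgK adj M0 ug sf xf (Kf _ _ zK) xz.
  move: EE' Eg E'k; set E := stack _; set E' := B *m _ => EE' Eg E'k.
  clearbody E E'.
  apply: (@GL_assemble _ _ _ g g d al E E'^T) => //.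
  - by rewrite -sadj_tr -EE' mulmx1.
  - by apply: trmx_inj; rewrite !trmx_mul trmxK E'k sadj_tr.
  - by rewrite subrr mxrank0.
rewrite dL in indx; have [z zK yz] := exists_dual sgK D.+1 indx.
pose a := cycle_left g D x; pose b := cycle_right g^T D z.
pose ta := 1%:M - sadj sg b *m a.
have aJ (i : nat) : (i <= D.+1)%N ->
    x *m g ^+ i *m ta = x *m g ^+ i - ((i == 0%N)%:R - (i == D.+1)%:R) *: a.
  move=> iD; rewrite mulmxBr mulmx1 mulmxA; congr (_ - _).
  have := pair_cycle_right adj yz iD; rewrite mulmx1 -/b => ->.
  by rewrite mul_scalar_mx.
have bJ (j : nat) : (j <= D)%N ->
    z *m g^T ^+ (D.+1 - j) *m ta^T = z *m g^T ^+ (D.+1 - j) - (j == 0%N)%:R *: b.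
  move=> jD; rewrite linearB /= trmx1 mulmxBr mulmx1 trmx_mul mulmxA; congr (_ - _).
  have := pair_cycle_left adj yz (leqW jD); rewrite mulmx1 -/a => /(congr1 trmx).
  rewrite sadj_tr trmx_mul trmxK => ->; rewrite [j == D.+1]ltn_eqF ?ltnS // subr0.
  by rewrite tr_scalar_mx mul_scalar_mx sadj_tr trmxK.
(* [1 - ta] squares to twice itself, because [a] and [b] pair to [2]; this makes [ta] an involution
   in every characteristic. *)
have ta2 : ta *m ta = 1%:M.
  have ab : a *m sadj sg b = 2%:R%:M.
    rewrite {1}/a /cycle_left mulmxBl.
    have := pair_cycle_right adj yz (leq0n _); rewrite expr0 !mulmx1 -/b => ->.
    have := pair_cycle_right adj yz (leqnn _); rewrite !mulmx1 -/b => ->.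
    by rewrite !eqxx /= sub0r subr0 -raddfB opprK.
  have QQ : sadj sg b *m a *m (sadj sg b *m a) = sadj sg b *m a + sadj sg b *m a.
    by rewrite -mulmxA (mulmxA a) ab mul_scalar_mx scaler_nat mulr2n mulmxDr.
  by rewrite /ta mulmxBl mul1mx [_ *m (1%:M - _)]mulmxBr mulmx1 QQ opprB addrK subrK.
have ug1 : g *m ta \in unitmx by rewrite unitmx_mul ug; case/mulmx1_unit: ta2.
apply: (@GL_assemble _ _ _ g (g *m ta) D (cycle_mx F D)
   (stack (fun i : 'I_D.+1 => x *m g ^+ i))
   (stack (fun i : 'I_D.+1 => z *m g^T ^+ (D.+1 - i)))^T) => //.
- exact: cycle_mx_unit.
- by have := cycle_dual adj yz; rewrite mulmx1 (sadj_tr _ _ (stack _)).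
- exact: (cycle_action_left aJ).
- apply: trmx_inj; rewrite !trmx_mul !trmxK (cycle_action_right sg bJ).
  by rewrite sadj_tr.
rewrite mulnC leq_mul2l -[X in X - _]mulmx1 -mulmxBr opprB addrC subrK /=.
apply: leq_trans (mxrankM_maxr _ _) _; apply: leq_trans (mxrankM_maxr _ _) _.
exact: rank_leq_row.
Qed.

End GL.

(** * Totally isotropic subspaces over finite fields *)

Section RowSpaces.
Variable F : fieldType.

Lemma row_outside m p n (A : 'M[F]_(m, n)) (B : 'M[F]_(p, n)) :
  (\rank B < \rank A)%N -> exists2 v : 'rV[F]_n, (v <= A)%MS & ~~ (v <= B)%MS.
Proof.
move=> lt; have /row_subPn[i iB] : ~~ (A <= B)%MS.
  by apply: contraL lt => /mxrankS; rewrite -leqNgt.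
by exists (row i A); rewrite ?row_sub.
Qed.

Lemma cap_kernels n e p m (N : nat -> 'M[F]_(n, p)) (S : 'M[F]_(m, n)) :
  exists S' : 'M[F]_n, [/\ (S' <= S)%MS, (\rank S <= \rank S' + e * p)%N &
    forall i q (v : 'M_(q, n)), (i < e)%N -> (v <= S')%MS -> v *m N i = 0].
Proof.
elim: e => [|e [S' [S'S rS HS]]].
  by exists <<S>>%MS; split=> //; rewrite ?genmxE ?addn0.
exists (S' :&: kermx (N e))%MS; split.
- exact: submx_trans (capmxSl _ _) S'S.
- have := mxrank_sum_cap S' (kermx (N e)); rewrite mxrank_ker.
  have := rank_leq_col (N e); have := rank_leq_row (N e).
  have := rank_leq_col (S' + kermx (N e))%MS; move: rS; rewrite mulSn.
  move: (\rank _) (\rank _) (\rank _) (\rank _) (\rank _) => a b c d f.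
  by move: (e * p)%N => g; lia.
move=> i q v; rewrite ltnS leq_eqVlt sub_capmx => /orP[/eqP->|ie] /andP[vS' vN].
  exact/sub_kermxP.
exact: HS.
Qed.

Lemma row_free_cons n s (x : 'rV[F]_n) (A : 'M[F]_(s, n)) :
  x != 0 -> row_free A -> (x :&: A = 0)%MS -> row_free (col_mx x A : 'M_(1 + s, n)).
Proof.
move=> x0 fA xA; rewrite /row_free -addsmxE mxrank_disjoint_sum // (eqP fA).
by rewrite rank_rV x0.
Qed.

End RowSpaces.

Section Isotropic.
Variables (F : fieldType) (sg : {rmorphism F -> F}).
Hypothesis sgK : involutive sg.

Definition norm_isotropic := forall c1 c2 c3 : F, exists a1 a2 a3 : F,
  [|| a1 != 0, a2 != 0 | a3 != 0] /\
  a1 * sg a1 * c1 + a2 * sg a2 * c2 + a3 * sg a3 * c3 = 0.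

Hypothesis norm_iso : norm_isotropic.

(** This covers quadratic forms as well as the maps sending [u] to [u J u^ad] with [J] arbitrary; as
    [J] may fail to be hermitian, the polarization has two separate terms. *)
Definition quadratic_map n (f : 'rV[F]_n -> F) :=
  (forall a u, f (a *: u) = a * sg a * f u) /\
  exists L L' : 'M[F]_n, forall u v,
    f (u + v) = f u + f v + (u *m L *m sadj sg v) 0 0 + (v *m L' *m sadj sg u) 0 0.

Variable n : nat.

Lemma quadratic_map_orthogonal (f : 'rV[F]_n -> F) (u : 'rV[F]_n) :
  quadratic_map f -> exists N : 'M[F]_(n, 2), forall v : 'rV_n, v *m N = 0 ->
    forall a, f (a *: u + v) = a * sg a * f u + f v.
Proof.
move=> [fZ [L [L' fD]]].
exists (row_mx (sadj sg L *m sadj sg u) (L' *m sadj sg u) : 'M_(n, 1 + 1)) => v vN a.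
have /eq_row_mx[e1 e2] : row_mx (v *m (sadj sg L *m sadj sg u)) (v *m (L' *m sadj sg u)) =
    row_mx 0 0 by rewrite -mul_mx_row row_mx0; exact: vN.
rewrite fD fZ sadjZ -scalemxAr -!scalemxAl -(mulmxA v) e2 scaler0 [in X in _ + X]mxE addr0.
have -> : u *m L *m sadj sg v = 0; last by rewrite !mxE mulr0 addr0.
by rewrite -[LHS](sadjK sgK) (sadjM _ (u *m L)) (sadjM _ u) (sadjK sgK v) e1 sadj0.
Qed.

(** On the span of three mutually orthogonal vectors [f] is diagonal, and [norm_iso] applies.
    Orthogonality to a vector costs two dimensions, so [7] leaves [3] for the last choice, one more
    than the span of the first two vectors. *)
Lemma isotropic_vector (f : 'rV[F]_n -> F) m (S : 'M[F]_(m, n)) :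
  quadratic_map f -> (7 <= \rank S)%N ->
  exists v : 'rV[F]_n, [/\ (v <= S)%MS, v != 0 & f v = 0].
Proof.
move=> qf rS.
have [x1 x1S] : exists2 v : 'rV_n, (v <= S)%MS & ~~ (v <= (0 : 'M_n))%MS.
  by apply: row_outside; rewrite mxrank0 (leq_trans _ rS).
rewrite submx0 => x10.
have [N1 HN1] := quadratic_map_orthogonal x1 qf.
have [S1 [S1S rS1 HS1]] := cap_kernels 1 (fun _ => N1) S.
have [x2 x2S x2x1] : exists2 v : 'rV_n, (v <= S1)%MS & ~~ (v <= x1)%MS.
  apply: row_outside; apply: leq_ltn_trans (rank_leq_row _) _.
  by move: rS rS1; move: (\rank S) (\rank S1) => a b; lia.
have [N2 HN2] := quadratic_map_orthogonal x2 qf.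
have [S2 [S2S1 rS2 HS2]] := cap_kernels 1 (fun _ => N2) S1.
have [x3 x3S x3x] : exists2 v : 'rV_n, (v <= S2)%MS & ~~ (v <= col_mx x1 x2)%MS.
  apply: row_outside; apply: leq_ltn_trans (rank_leq_row _) _.
  by move: rS rS1 rS2; move: (\rank S) (\rank S1) (\rank S2) => a b c; lia.
have [a1 [a2 [a3 [nz sol]]]] := norm_iso (f x1) (f x2) (f x3).
exists (a1 *: x1 + (a2 *: x2 + a3 *: x3)); split.
- rewrite !addmx_sub ?scalemx_sub //; first exact: submx_trans S1S.
  exact: submx_trans x3S (submx_trans S2S1 S1S).
- apply/eqP => e0; case/or3P: nz => [a0|a0|a0].
  + have [a30|a30] := eqVneq a3 0; last first.
      case/negP: x3x; rewrite -(scalerK a30 x3) scalemx_sub //.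
      move/eqP: e0; rewrite addrA addrC addr_eq0 => /eqP->; rewrite eqmx_opp addmx_sub //.
        by rewrite scalemx_sub // -addsmxE addsmxSl.
      by rewrite scalemx_sub // -addsmxE addsmxSr.
    have [a20|a20] := eqVneq a2 0; last first.
      case/negP: x2x1; rewrite -(scalerK a20 x2) scalemx_sub //.
      move/eqP: e0; rewrite a30 scale0r addr0 addrC addr_eq0 => /eqP->.
      by rewrite eqmx_opp scalemx_sub.
    move/eqP: e0; rewrite a20 a30 !scale0r !addr0 scaler_eq0 (negPf a0) /=.
    by rewrite (negPf x10).
  + have [a30|a30] := eqVneq a3 0; last first.
      case/negP: x3x; rewrite -(scalerK a30 x3) scalemx_sub //.
      move/eqP: e0; rewrite addrA addrC addr_eq0 => /eqP->; rewrite eqmx_opp addmx_sub //.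
        by rewrite scalemx_sub // -addsmxE addsmxSl.
      by rewrite scalemx_sub // -addsmxE addsmxSr.
    case/negP: x2x1; rewrite -(scalerK a0 x2) scalemx_sub //.
    move/eqP: e0; rewrite a30 scale0r addr0 addrC addr_eq0 => /eqP->.
    by rewrite eqmx_opp scalemx_sub.
  + case/negP: x3x; rewrite -(scalerK a0 x3) scalemx_sub //.
    move/eqP: e0; rewrite addrA addrC addr_eq0 => /eqP->; rewrite eqmx_opp addmx_sub //.
      by rewrite scalemx_sub // -addsmxE addsmxSl.
    by rewrite scalemx_sub // -addsmxE addsmxSr.
- have fZ := qf.1; rewrite HN1 ?HN2 ?fZ ?addrA //.
    by apply: (HS2 0%N) => //; rewrite scalemx_sub.
  by apply: (HS1 0%N) => //; rewrite addmx_sub ?scalemx_sub // (submx_trans x3S).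
Qed.

(** Each new vector costs three dimensions: two for orthogonality, one for a complement of the
    vector. *)
Lemma isotropic_subspace (f : 'rV[F]_n -> F) s m (S : 'M[F]_(m, n)) :
  quadratic_map f -> (3 * s + 7 <= \rank S)%N ->
  exists A : 'M[F]_(s, n), [/\ row_free A, (A <= S)%MS & forall u, f (u *m A) = 0].
Proof.
move=> qf; have f0 : f 0 = 0 by rewrite -(scale0r 0) qf.1 !mul0r.
elim: s m S => [|s IH] m S rS.
  exists 0; split; [|exact: sub0mx|by move=> u; rewrite mulmx0].
  by rewrite /row_free mxrank0.
have [|x [xS x0 fx]] := isotropic_vector (S := S) qf; first by lia.
have [N HN] := quadratic_map_orthogonal x qf.
have [S1 [S1S rS1 HS1]] := cap_kernels 1 (fun _ => N) S.
have [|A [fA AS fnull]] := IH _ (S1 :\: x)%MS.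
  have := mxrank_cap_compl S1 x; have := mxrankS (capmxSr S1 x).
  rewrite rank_rV x0; move: rS rS1.
  by move: (\rank _) (\rank _) (\rank _) (\rank _) => a b c d; lia.
have AS1 : (A <= S1)%MS := submx_trans AS (diffmxSl _ _).
exists (col_mx x A : 'M_(1 + s, n)); split.
- apply: row_free_cons => //; apply/eqP; rewrite -submx0 -(capmx_diff S1 x).
  by rewrite capmxC capmxS.
- by have := col_mx_sub x A S; rewrite xS (submx_trans AS1 S1S).
move=> u; pose u' := u : 'rV_(1 + s).
have -> : u *m (col_mx x A : 'M_(1 + s, n)) = lsubmx u' *m x + rsubmx u' *m A.
  by rewrite -mul_row_col hsubmxK.
rewrite [lsubmx u']mx11_scalar mul_scalar_mx HN ?fx ?mulr0 ?fnull ?addr0 //.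
by apply: (HS1 0%N) => //; apply: mulmx_sub.
Qed.

Fixpoint isotropic_bound e s := if e is e'.+1 then (3 * isotropic_bound e' s + 7)%N else s.

(** A large subspace on which one map vanishes serves as the ambient space for the next map, whence
    the iterated bound. *)
Lemma common_isotropic_subspace e (f : nat -> 'rV[F]_n -> F) s m (S : 'M[F]_(m, n)) :
  (forall i, (i < e)%N -> quadratic_map (f i)) -> (isotropic_bound e s <= \rank S)%N ->
  exists A : 'M[F]_(s, n), [/\ row_free A, (A <= S)%MS &
    forall i v, (i < e)%N -> (v <= A)%MS -> f i v = 0].
Proof.
elim: e m S => [|e IH] m S qf rS.
  have [T fT TS] : exists2 T : 'M[F]_(s, n), row_free T & (T <= S)%MS.
    exists (pid_mx s *m row_base S); last first.
      by rewrite (submx_trans (submxMl _ _)) // eq_row_base.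
    by rewrite /row_free mxrankMfree ?row_base_free ?rank_pid_mx.
  by exists T.
have [A [fA AS nA]] := isotropic_subspace (qf e (ltnSn e)) rS.
have [i ie||T [fT TA nT]] := IH _ A; first exact/qf/ltnW.
  by rewrite (eqP fA).
exists T; split=> //; first exact: submx_trans AS.
move=> i v; rewrite ltnS leq_eqVlt => /orP[/eqP->|ie] vT; last exact: nT.
by have /submxP[u ->] := submx_trans vT TA.
Qed.

Lemma sesquilinear_quadratic_map (J : 'M[F]_n) :
  quadratic_map (fun u => (u *m J *m sadj sg u) 0 0).
Proof.
split=> [a u|]; last exists J, J => u v.
  by rewrite sadjZ -scalemxAr -!scalemxAl !mxE; ring.
by rewrite sadjD !mulmxDl !mulmxDr !mxE; ring.
Qed.

Definition totally_isotropic_bound e s := (isotropic_bound e.+1 1 + s * (2 * e).+1)%N.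

(** Each basis vector is a common zero of [Q] and the [e] forms. The next ones are sought where they
    are orthogonal to it on both sides for every [J i], at the cost of [2 * e] dimensions and one
    more for a complement. As [J 0] polarizes [Q] up to [c], [Q] vanishes on sums too. *)
Lemma totally_isotropic_subspace e (J : nat -> 'M[F]_n) (Q : 'rV[F]_n -> F) (c : F)
    s m (S : 'M[F]_(m, n)) : (0 < e)%N ->
  (forall a u, Q (a *: u) = a * sg a * Q u) ->
  (forall u v, Q (u + v) = Q u + Q v + c * (u *m J 0%N *m sadj sg v) 0 0) ->
  (totally_isotropic_bound e s <= \rank S)%N ->
  exists A : 'M[F]_(s, n), [/\ row_free A, (A <= S)%MS,
    forall i, (i < e)%N -> A *m J i *m sadj sg A = 0 & forall u, Q (u *m A) = 0].
Proof.
move=> e0 QZ QD; have Q0 : Q 0 = 0 by rewrite -(scale0r 0) QZ !mul0r.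
elim: s m S => [|s IH] m S rS.
  exists 0; split; [|exact: sub0mx| |by move=> u; rewrite mulmx0].
    by rewrite /row_free mxrank0.
  by move=> i _; rewrite !mul0mx.
pose f i := if (i < e)%N then fun u : 'rV[F]_n => (u *m J i *m sadj sg u) 0 0 else Q.
have qf i : quadratic_map (f i).
  rewrite /f; case: ifP => _; first exact: sesquilinear_quadratic_map.
  split=> //; exists (c *: J 0%N), 0 => u v.
  by rewrite QD mulmx0 mul0mx -scalemxAr -scalemxAl !mxE addr0.
have [//||X [fX XS nX]] := @common_isotropic_subspace e.+1 f 1 _ S.
  exact: leq_trans (leq_addr _ _) rS.
pose x := X : 'rV_n; have x0 : x != 0.
  by move: fX; rewrite /row_free rank_rV /x; case: (X == 0).
pose N i := row_mx (J i *m sadj sg x) (sadj sg (J i) *m sadj sg x) : 'M_(n, 1 + 1).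
have [S1 [S1S rS1 HS1]] := cap_kernels e N S.
have [|A [fA AS JA QA]] := IH _ (S1 :\: x)%MS.
  have := mxrank_cap_compl S1 x; have := mxrankS (capmxSr S1 x).
  rewrite rank_rV x0; move: rS rS1; rewrite /totally_isotropic_bound mulSn.
  move: (\rank _) (\rank _) (\rank _) (\rank _) => a b d g.
  by move: (s * _)%N (isotropic_bound _ _) => p q; lia.
have AS1 : (A <= S1)%MS := submx_trans AS (diffmxSl _ _).
have AN i : (i < e)%N ->
    A *m J i *m sadj sg x = 0 /\ x *m J i *m sadj sg A = 0.
  move=> ie; have AN := HS1 i _ A ie AS1.
  have /eq_row_mx[e1 e2] : row_mx (A *m (J i *m sadj sg x))
      (A *m (sadj sg (J i) *m sadj sg x)) = row_mx 0 0.
    by rewrite -mul_mx_row row_mx0; exact: AN.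
  split; first by rewrite -mulmxA.
  by rewrite -[LHS](sadjK sgK) (sadjM _ (x *m J i)) (sadjM _ x) (sadjK sgK A) e2 sadj0.
have Jx i : (i < e)%N -> x *m J i *m sadj sg x = 0.
  move=> ie; apply/rowP => j; rewrite [j]ord1 [RHS]mxE.
  by have := nX i x (ltnW ie) (submx_refl _); rewrite /f ie.
exists (col_mx x A : 'M_(1 + s, n)); split.
- apply: row_free_cons => //; apply/eqP; rewrite -submx0 -(capmx_diff S1 x).
  by rewrite capmxC capmxS.
- by have := col_mx_sub x A S; rewrite XS (submx_trans AS1 S1S).
- move=> i ie; have [e1 e2] := AN i ie; pose xA := col_mx x A : 'M_(1 + s, n).
  have exA : sadj sg xA = row_mx (sadj sg x) (sadj sg A).
    by rewrite /sadj tr_col_mx map_row_mx.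
  suff : xA *m J i *m sadj sg xA = 0 by [].
  rewrite exA mul_col_mx mul_col_row (Jx _ ie) e1 e2 (JA _ ie).
  by rewrite -[LHS]/(block_mx 0 0 0 0) block_mx_const.
move=> u; pose u' := u : 'rV_(1 + s).
have -> : u *m (col_mx x A : 'M_(1 + s, n)) = lsubmx u' *m x + rsubmx u' *m A.
  by rewrite -mul_row_col hsubmxK.
rewrite QD QA [lsubmx u']mx11_scalar mul_scalar_mx QZ sadjM -!scalemxAl !mulmxA.
have [_ ->] := AN _ e0; rewrite mul0mx scaler0 [X in c * X]mxE mulr0 !addr0.
have := nX e x (ltnSn e) (submx_refl _); rewrite /f ltnn => ->.
by rewrite mulr0.
Qed.

End Isotropic.

(** * Zeros of diagonal forms in three variables over finite fields *)

Lemma card_fibers (T U : finType) (f : T -> U) (A : {set T}) k :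
  (forall y, #|[set x in A | f x == y]| <= k)%N -> (#|A| <= k * #|f @: A|)%N.
Proof.
move=> fk; rewrite -sum1_card (partition_big_imset f) /= mulnC -sum_nat_const.
apply: leq_sum => y _; apply: leq_trans (fk y).
by rewrite -sum1_card; under [leqRHS]eq_bigl do rewrite inE.
Qed.

Section Norms.
Variable F : finFieldType.

Lemma card_roots (p : {poly F}) (A : {set F}) :
  p != 0 -> (forall x, x \in A -> root p x) -> (#|A| < size p)%N.
Proof.
move=> p0 Ap; rewrite cardE; apply: max_poly_roots => //; last exact: enum_uniq.
by apply/allP => x; rewrite mem_enum => /Ap.
Qed.

(** Squaring has fibres of size at most two; zero is alone in its fibre, which makes the inequality
    strict. *)
Lemma card_squares : (#|F| < 2 * #|[set x ^+ 2 | x in [set: F]]|)%N.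
Proof.
pose A := [set~ (0 : F)].
have cA : #|F| = #|A|.+1 by rewrite -cardsT (cardsD1 0) inE setTD.
have -> : [set x ^+ 2 | x in [set: F]] = 0 |: [set x ^+ 2 | x in A].
  apply/setP => y; rewrite in_setU1; apply/imsetP/idP => [[x _ ->]|].
    have [->|x0] := eqVneq x 0; first by rewrite expr0n eqxx.
    by apply/orP; right; apply/imsetP; exists x; rewrite ?inE.
  case/orP => [/eqP->|/imsetP[x _ ->]]; last by exists x.
  by exists 0; rewrite ?expr0n.
rewrite cardsU1 (_ : (0 \in _) = false); last first.
  apply/negP => /imsetP[x]; rewrite !inE => x0 /esym/eqP.
  by rewrite expf_eq0 /= (negPf x0).
rewrite cA mulnDr /=; apply: leq_ltn_trans (_ : 2 * #|[set x ^+ 2 | x in A]| + 1 < _)%N.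
  rewrite addn1 ltnS; apply: card_fibers => y.
  have p0 : 'X^2 - y%:P != 0 by rewrite -size_poly_eq0 size_XnsubC.
  rewrite -ltnS; apply: leq_trans (card_roots p0 _) _; last by rewrite size_XnsubC.
  by move=> x; rewrite !inE => /andP[_ /eqP<-]; rewrite rootE !hornerE subrr.
by rewrite addnC ltn_add2r.
Qed.

(** More than half of the elements are squares, so the values [c1 * x^2] and [- c3 - c2 * y^2]
    overlap; this gives a zero with third variable [1]. *)
Lemma norm_isotropic_id (sg : {rmorphism F -> F}) :
  (forall x, sg x = x) -> norm_isotropic sg.
Proof.
move=> sgE c1 c2 c3.
have [->|c10] := eqVneq c1 0.
  by exists 1, 0, 0; rewrite oner_eq0; split=> //; ring.
have [->|c20] := eqVneq c2 0.
  by exists 0, 1, 0; rewrite oner_eq0 orbT; split=> //; ring.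
pose S := [set x ^+ 2 | x in [set: F]].
pose A := [set c1 * y | y in S]; pose B := [set - c3 - c2 * y | y in S].
have cA : #|A| = #|S| by apply: card_imset; apply: mulfI.
have cB : #|B| = #|S|.
  by apply: card_imset => x y /addrI /oppr_inj /(mulfI c20).
have /set0Pn[y] : A :&: B != set0.
  rewrite -card_gt0; have := cardsUI A B; rewrite cA cB addnn -mul2n.
  have := card_squares; have := max_card (mem (A :|: B)).
  by move: #|_| #|_| #|_| #|_| => a b c d; lia.
rewrite inE => /andP[/imsetP[_ /imsetP[a1 _ ->] ->] /imsetP[_ /imsetP[a2 _ ->]] e].
exists a1, a2, 1; rewrite oner_eq0 !orbT !sgE; split=> //.
by rewrite -!expr2 ![_ ^+ 2 * _]mulrC e; ring.
Qed.

Lemma frobenius_involutive (sg : {rmorphism F -> F}) (q : nat) :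
  #|F| = (q ^ 2)%N -> (forall x, sg x = x ^+ q) -> involutive sg.
Proof. by move=> cF sgE x; rewrite !sgE -exprM -(expnS q 1) -cF expf_card. Qed.

(* Norms are exactly the elements of the fixed field of sg, over which F has    *)
(* dimension 2; so c1, c2, c3 are linearly dependent over the norms.            *)
Lemma norm_isotropic_frobenius (sg : {rmorphism F -> F}) (q : nat) :
  #|F| = (q ^ 2)%N -> (forall x, sg x = x ^+ q) -> norm_isotropic sg.
Proof.
move=> cF sgE; have sgK := frobenius_involutive cF sgE.
have q1 : (1 < q)%N.
  by have := card_finNzRing_gt1 F; rewrite cF; case: q {cF sgE} => [|[|]].
pose F0 := [set x | sg x == x].
pose N x := x * sg x; pose A := [set~ (0 : F)].
have cA : #|F| = #|A|.+1 by rewrite -cardsT (cardsD1 0) inE setTD.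
have N0 : 0 \notin N @: A.
  apply/imsetP => -[x]; rewrite !inE => x0 /esym/eqP.
  by rewrite mulf_eq0 fmorph_eq0 (negPf x0).
have cN : (q.-1 <= #|N @: A|)%N.
  rewrite -(leq_pmul2l (ltn0Sn q)).
  apply: leq_trans (_ : #|A| <= _)%N.
    by rewrite -ltnS -cA cF -mulnn; case: q q1 {cF sgE} => // q' _ /=; nia.
  apply: card_fibers => y.
  have p0 : 'X^(q.+1) - y%:P != 0 by rewrite -size_poly_eq0 size_XnsubC.
  rewrite -ltnS; apply: leq_trans (card_roots p0 _) _; last by rewrite size_XnsubC.
  move=> x; rewrite !inE => /andP[_ /eqP<-].
  by rewrite rootE !hornerE /N sgE exprS subrr.
have cF0 : (#|F0| <= q)%N.
  have sp : size ('X^q - 'X : {poly F}) = q.+1.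
    by rewrite size_polyDl ?size_polyXn // size_polyN size_polyX.
  have p0 : 'X^q - 'X != 0 :> {poly F} by rewrite -size_poly_eq0 sp.
  rewrite -ltnS -sp; apply: card_roots => // x.
  by rewrite inE sgE rootE !hornerE subr_eq0.
have sub : 0 |: N @: A \subset F0.
  apply/subsetP => y; rewrite in_setU1 => /orP[/eqP->|/imsetP[x _ ->]].
    by rewrite inE rmorph0.
  by rewrite inE /N rmorphM sgK mulrC.
have cU : #|0 |: N @: A| = #|N @: A|.+1 by rewrite cardsU1 N0.
have eF0 : 0 |: N @: A = F0.
  apply/eqP; rewrite eqEcard sub cU (leq_trans cF0) //.
  by rewrite -(prednK (ltnW q1)) ltnS.
have cF0' : #|F0| = q.
  by apply/eqP; rewrite eqn_leq cF0 -eF0 cU -(prednK (ltnW q1)) ltnS.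
move=> c1 c2 c3; pose h (l : F * F * F) := l.1.1 * c1 + l.1.2 * c2 + l.2 * c3.
pose D := setX (setX F0 F0) F0.
have [l [l' [lD l'D ll' eh]]] : exists l l', [/\ l \in D, l' \in D, l != l' & h l = h l'].
  have /dinjectivePn[l lD [l' /andP[l'l l'D] eh]] : ~~ dinjectiveb h D.
    apply/negP => /dinjectiveP injh.
    have := max_card (mem (h @: D)); rewrite (card_in_imset injh) !cardsX cF0' cF.
    by rewrite -mulnn leqNgt -{1}[(q * q)%N]muln1 ltn_mul2l muln_gt0 (ltnW q1) q1.
  by exists l, l'; split=> //; rewrite eq_sym.
have normP x y : x \in F0 -> y \in F0 -> exists2 a, a * sg a = x - y & (a != 0) = (x != y).
  rewrite !inE => /eqP sx /eqP sy.
  have : x - y \in 0 |: N @: A by rewrite eF0 inE rmorphB sx sy.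
  rewrite in_setU1 subr_eq0; have [->|xy] := eqVneq x y.
    by exists 0; rewrite ?mul0r ?subrr ?eqxx.
  by move=> /imsetP[a]; rewrite !inE => a0 ->; exists a.
case: l l' lD l'D ll' eh => [[x1 x2] x3] [[y1 y2] y3].
rewrite !in_setX -!andbA => /and3P[Fx1 Fx2 Fx3] /and3P[Fy1 Fy2 Fy3] xy eh.
have [a1 e1 n1] := normP _ _ Fx1 Fy1; have [a2 e2 n2] := normP _ _ Fx2 Fy2.
have [a3 e3 n3] := normP _ _ Fx3 Fy3.
exists a1, a2, a3; rewrite n1 n2 n3 e1 e2 e3; split.
  by apply: contraR xy; rewrite !negb_or !negbK => /and3P[/eqP-> /eqP-> /eqP->].
have : h (x1, x2, x3) - h (y1, y2, y3) = 0 by rewrite eh subrr.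
by rewrite /h /= => <-; ring.
Qed.

End Norms.

(** * Isometry groups *)

Section Forms.
Variables (F : finFieldType) (sg : {rmorphism F -> F}) (et c : F).
Hypothesis sgK : involutive sg.
Hypothesis et2 : et * et = 1.
Hypothesis sg_et : sg et = et.
Hypothesis c_et : c = 0 \/ (forall x, sg x = x) /\ et = 1.

Local Notation "A ^ad" := (sadj sg A) (at level 1, format "A ^ad").

(* Symplectic, unitary and orthogonal geometries at once: form_mx is the Gram   *)
(* matrix of the alternating, hermitian or polar form, et is its sign, and      *)
(* c = 1 in the orthogonal case, while c = 0 and form_quad = 0 otherwise. A     *)
(* radical is allowed, for quadratic forms in odd dimension and characteristic  *)
(* 2; the bound 6 on its dimension is what isotropic_vector gives.              *)
Record geometry n := Geometry {
  form_mx :> 'M[F]_n;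
  form_quad : 'rV[F]_n -> F;
  form_sym : form_mx^ad = et *: form_mx;
  form_rank : (n <= \rank form_mx + 6)%N;
  form_quadZ : forall a u, form_quad (a *: u) = a * sg a * form_quad u;
  form_quadD : forall u v, form_quad (u + v) =
    form_quad u + form_quad v + c * (u *m form_mx *m v^ad) 0 0 }.

Definition form_iso n (s : geometry n) (g : 'M[F]_n) :=
  [/\ g \in unitmx, g *m s *m g^ad = s & forall u, form_quad s (u *m g) = form_quad s u].

Lemma form_iso1 n (s : geometry n) : form_iso s 1%:M.
Proof.
by split; rewrite ?unitmx1 ?mul1mx ?sadj1 ?mulmx1 // => u; rewrite mulmx1.
Qed.

Lemma form_iso_unit n (s : geometry n) g : form_iso s g -> g \in unitmx.
Proof. by case. Qed.

Lemma form_isoM n (s : geometry n) g h : form_iso s g -> form_iso s h -> form_iso s (g *m h).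
Proof.
move=> [ug gJ gQ] [uh hJ hQ]; split; first by rewrite unitmx_mul ug.
  by rewrite sadjM mulmxA -(mulmxA g) -(mulmxA g) hJ gJ.
by move=> u; rewrite mulmxA hQ.
Qed.

Lemma form_sym_pair n (s : geometry n) m p (u : 'M_(m, n)) (v : 'M_(p, n)) :
  v *m s *m u^ad = et *: (u *m s *m v^ad)^ad.
Proof.
by rewrite !sadjM (sadjK sgK) form_sym -scalemxAl -scalemxAr scalerA et2 scale1r mulmxA.
Qed.

Lemma form_orthogonal_sym n (s : geometry n) m p (u : 'M_(m, n)) (v : 'M_(p, n)) :
  u *m s *m v^ad = 0 -> v *m s *m u^ad = 0.
Proof. by move=> e; rewrite form_sym_pair e sadj0 scaler0. Qed.

Lemma form_quad0 n (s : geometry n) : form_quad s 0 = 0.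
Proof. by rewrite -(scale0r 0) form_quadZ !mul0r. Qed.

Definition isotropic n (s : geometry n) m (E : 'M[F]_(m, n)) :=
  E *m s *m E^ad = 0 /\ forall u, form_quad s (u *m E) = 0.

Lemma isotropic_mul n (s : geometry n) m p (A : 'M[F]_(p, m)) (E : 'M[F]_(m, n)) :
  isotropic s E -> isotropic s (A *m E).
Proof.
move=> [E0 QE]; split=> [|u]; last by rewrite mulmxA QE.
by rewrite sadjM mulmxA -(mulmxA A) -(mulmxA A) E0 mulmx0 mul0mx.
Qed.

Lemma isotropic_stack n (s : geometry n) d m (f : 'I_d -> 'M[F]_(m, n)) :
  (forall i j, f i *m s *m (f j)^ad = 0) ->
  (forall i u, form_quad s (u *m f i) = 0) -> isotropic s (stack f).
Proof.
move=> f0 Qf; split=> [|u]; first exact: stack_pair0.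
rewrite mul_row_stack; set U := \matrix_(i, j) _; pose r i := row i U *m f i.
suff [] : form_quad s (\sum_i r i) = 0 /\ forall j, r j *m s *m (\sum_i r i)^ad = 0 by [].
elim/big_rec: _ => [|i v _ [Qv rv]].
  by split; [apply: form_quad0 | move=> j; rewrite sadj0 mulmx0].
have rr j l : r j *m s *m (r l)^ad = 0.
  by rewrite /r sadjM mulmxA -!(mulmxA (row j _)) f0 mul0mx mulmx0.
split=> [|j]; last by rewrite sadjD mulmxDr rv rr addr0.
by rewrite form_quadD Qf Qv rv mxE mulr0 !addr0.
Qed.

Section HyperbolicSplit.
Variables (n r b : nat) (s : geometry n).
Variables (E E' : 'M[F]_(r, n)) (C : 'M[F]_(b, n)) (C' : 'M[F]_(n, b)).
Hypotheses (isoE : isotropic s E) (isoE' : isotropic s E').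
Hypothesis dualE : E *m s *m E'^ad = 1%:M.
(** [P], [P'] and [C'] read off the coordinates of a row along [E], [E'] and the orthogonal
    complement spanned by [C]; [sum1] is the resulting resolution of the identity. *)
Variables (P P' : 'M[F]_(n, r)).
Hypotheses (eP : P = s *m E'^ad) (eP' : P' = et *: (s *m E^ad)).
Hypotheses (en : n = (2 * r + b)%N) (CC' : C *m C' = 1%:M).
Hypotheses (CP : C *m P = 0) (CP' : C *m P' = 0).
Hypotheses (EC' : E *m C' = 0) (E'C' : E' *m C' = 0).
Hypothesis sum1 : P *m E + P' *m E' + C' *m C = 1%:M.

Let EP : E *m P = 1%:M. Proof. by rewrite eP mulmxA dualE. Qed.
Let EP' : E *m P' = 0.
Proof. by rewrite eP' -scalemxAr mulmxA isoE.1 scaler0. Qed.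
Let E'P : E' *m P = 0. Proof. by rewrite eP mulmxA isoE'.1. Qed.
Let E'P' : E' *m P' = 1%:M.
Proof.
by rewrite eP' -scalemxAr mulmxA form_sym_pair dualE sadj1 scalerA et2 scale1r.
Qed.
Let Padj : P^ad = et *: (E' *m s).
Proof. by rewrite eP sadjM (sadjK sgK) form_sym scalemxAr. Qed.
Let P'adj : P'^ad = E *m s.
Proof.
by rewrite eP' sadjZ sadjM (sadjK sgK) form_sym -scalemxAr scalerA sg_et et2 scale1r.
Qed.
Let CE : C *m s *m E^ad = 0.
Proof.
have := congr1 (fun A => et *: A) CP'.
by rewrite eP' scaler0 -scalemxAr scalerA et2 scale1r mulmxA.
Qed.
Let CE' : C *m s *m E'^ad = 0. Proof. by rewrite -mulmxA -eP. Qed.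
Let EC : E *m s *m C^ad = 0. Proof. exact: form_orthogonal_sym. Qed.
Let E'C : E' *m s *m C^ad = 0. Proof. exact: form_orthogonal_sym. Qed.

Let C'adj : C *m s = C *m s *m C^ad *m C'^ad.
Proof.
rewrite -[LHS]mulmx1 -[1%:M](sadj1 sg) -sum1 !sadjD !sadjM !mulmxDr !mulmxA.
by rewrite CE CE' !mul0mx !add0r.
Qed.

Let restrict_sym : (C *m s *m C^ad)^ad = et *: (C *m s *m C^ad).
Proof.
by rewrite !sadjM (sadjK sgK) form_sym -scalemxAl -scalemxAr mulmxA.
Qed.

(** The hyperbolic part accounts for at most [2 * r] of the rank, so the defect of the restriction
    is no larger than that of [s]. *)
Let restrict_rank : (b <= \rank (C *m s *m C^ad) + 6)%N.
Proof.
have eJ : form_mx s = P *m (E *m s) + P' *m (E' *m s) + C' *m (C *m s *m C^ad *m C'^ad).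
  by rewrite -C'adj !mulmxA -!mulmxDl sum1 mul1mx.
have : (\rank (form_mx s) <= r + r + \rank (C *m s *m C^ad))%N.
  rewrite {1}eJ; apply: leq_trans (mxrank_add _ _) _; apply: leq_add.
    apply: leq_trans (mxrank_add _ _) _; apply: leq_add;
      by apply: leq_trans (mxrankM_maxl _ _) (rank_leq_col _).
  by apply: leq_trans (mxrankM_maxr _ _) (mxrankM_maxl _ _).
have := form_rank s; rewrite {1}en; move: (\rank _) (\rank _) => x y; lia.
Qed.

Let restrict_quadD u v : form_quad s ((u + v) *m C) = form_quad s (u *m C) +
  form_quad s (v *m C) + c * (u *m (C *m s *m C^ad) *m v^ad) 0 0.
Proof. by rewrite mulmxDl form_quadD sadjM !mulmxA. Qed.

Definition restrict_form : geometry b :=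
  @Geometry b (C *m s *m C^ad) (fun u => form_quad s (u *m C)) restrict_sym restrict_rank
  (fun a u => etrans (congr1 (form_quad s) (esym (scalemxAl a u C))) (form_quadZ s a (u *m C)))
  restrict_quadD.

Definition hyperbolic_iso (A : 'M[F]_r) (X : 'M[F]_b) : 'M[F]_n :=
  P *m A *m E + P' *m (invmx A)^ad *m E' + C' *m X *m C.

Local Notation Phi := hyperbolic_iso.

Let EPhi A X : E *m Phi A X = A *m E.
Proof.
by rewrite /Phi !mulmxDr !mulmxA EP EP' EC' mul1mx !mul0mx !addr0.
Qed.
Let E'Phi A X : E' *m Phi A X = (invmx A)^ad *m E'.
Proof.
by rewrite /Phi !mulmxDr !mulmxA E'P E'P' E'C' mul1mx !mul0mx add0r addr0.
Qed.
Let CPhi A X : C *m Phi A X = X *m C.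
Proof.
by rewrite /Phi !mulmxDr !mulmxA CP CP' CC' mul1mx !mul0mx !add0r.
Qed.

Lemma hyperbolic_iso1 : Phi 1%:M 1%:M = 1%:M.
Proof. by rewrite /Phi invmx1 sadj1 !mulmx1 sum1. Qed.

Lemma hyperbolic_isoM A A' X X' : A \in unitmx -> A' \in unitmx ->
  Phi (A *m A') (X *m X') = Phi A X *m Phi A' X'.
Proof.
move=> uA uA'; have iM : invmx (A *m A') = invmx A' *m invmx A.
  have uAA' : A *m A' \in unitmx by rewrite unitmx_mul uA.
  by rewrite -[RHS]mulmx1 -(mulmxV uAA') mulmxA !mulmxA mulmxKV // mulVmx // mul1mx.
rewrite {2}/Phi !mulmxDl -[P *m A *m E *m _]mulmxA -[P' *m _ *m E' *m _]mulmxA.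
rewrite -[C' *m X *m C *m _]mulmxA EPhi E'Phi CPhi /Phi iM sadjM.
by rewrite !mulmxA.
Qed.

Let quad_split p p' x : form_quad s (p *m E + p' *m E' + x *m C) =
  c * (p *m p'^ad) 0 0 + form_quad s (x *m C).
Proof.
have x0 : (p *m E + p' *m E') *m s *m (x *m C)^ad = 0.
  rewrite sadjM !mulmxDl !mulmxA -!(mulmxA p) -!(mulmxA p') EC E'C.
  by rewrite !(mul0mx, mulmx0) addr0.
rewrite form_quadD x0 [X in c * X]mxE mulr0 addr0 form_quadD isoE.2 isoE'.2 !add0r.
congr (c * _ _ _ + _).
by rewrite sadjM mulmxA -!(mulmxA p) dualE mul1mx.
Qed.

Lemma hyperbolic_iso_form A X : A \in unitmx -> form_iso restrict_form X ->
  form_iso s (Phi A X).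
Proof.
move=> uA [uX XJ XQ].
split.
- have : Phi A X *m Phi (invmx A) (invmx X) = 1%:M.
    by rewrite -hyperbolic_isoM ?unitmx_inv // !mulmxV // hyperbolic_iso1.
  by case/mulmx1_unit.
- have Phi_adj : (Phi A X)^ad = E^ad *m A^ad *m P^ad + E'^ad *m invmx A *m P'^ad +
      C^ad *m X^ad *m C'^ad.
    by rewrite /Phi !sadjD !sadjM (sadjK sgK) !mulmxA.
  set N := _ *m (_)^ad.
  have EN : E *m N = E *m s.
    have e : E *m s *m (Phi A X)^ad = invmx A *m (E *m s).
      rewrite Phi_adj !mulmxDr !mulmxA isoE.1 dualE EC !mul0mx add0r addr0 mul1mx.
      by rewrite P'adj mulmxA.
    by rewrite /N !mulmxA EPhi -2!(mulmxA A) e mulmxA mulmxV // mul1mx.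
  have E'N : E' *m N = E' *m s.
    have e : E' *m s *m (Phi A X)^ad = A^ad *m (E' *m s).
      rewrite Phi_adj !mulmxDr !mulmxA isoE'.1 E'C form_sym_pair dualE sadj1.
      rewrite !mul0mx !addr0 -!scalemxAl mul1mx Padj -scalemxAr scalerA et2 scale1r.
      by rewrite mulmxA.
    rewrite /N !mulmxA E'Phi -2!(mulmxA (invmx A)^ad) e mulmxA -sadjM mulmxV //.
    by rewrite sadj1 mul1mx.
  have CN : C *m N = C *m s.
    have e : C *m s *m (Phi A X)^ad = C *m s *m C^ad *m X^ad *m C'^ad.
      by rewrite Phi_adj !mulmxDr !mulmxA CE CE' !mul0mx !add0r.
    rewrite /N !mulmxA CPhi -2!(mulmxA X) e [RHS]C'adj.
    have /= eX := XJ; rewrite -[in RHS]eX; rewrite !mulmxA.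
    by [].
  rewrite -[N]mul1mx -[form_mx s]mul1mx -sum1 !mulmxDl -!mulmxA.
  by rewrite EN E'N CN.
move=> u; have eu : u = (u *m P) *m E + (u *m P') *m E' + (u *m C') *m C.
  by rewrite -!mulmxA -!mulmxDr sum1 mulmx1.
rewrite [in RHS]eu quad_split {1}eu !mulmxDl -!(mulmxA _ _ (Phi A X)).
rewrite EPhi E'Phi CPhi (mulmxA (u *m P)) (mulmxA (u *m P')) (mulmxA (u *m C')) quad_split.
have /= -> := XQ (u *m C'); congr (c * _ _ _ + _).
by rewrite sadjM (sadjK sgK) mulmxA mulmxK.
Qed.

(** An isometry that preserves the spans of [E] and [E'] preserves their orthogonal complement. *)
Lemma hyperbolic_iso_restrict (A : 'M[F]_r) g1 : A \in unitmx -> form_iso s g1 ->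
  E *m g1 = A *m E -> E' = A^ad *m E' *m g1 ->
  form_iso restrict_form (C *m g1 *m C') /\ g1 = Phi A (C *m g1 *m C').
Proof.
move=> uA [ug gJ gQ] Eg E'g.
have E'g' : E' *m g1 = (invmx A)^ad *m E'.
  by rewrite {2}E'g !mulmxA -sadjM mulmxV // sadj1 mul1mx.
have Jg m (z : 'M_(m, n)) : C *m g1 *m s *m (z *m g1)^ad = C *m s *m z^ad.
  by rewrite sadjM mulmxA -2!(mulmxA C) gJ.
have CgP : C *m g1 *m P = 0.
  by rewrite eP mulmxA E'g Jg sadjM mulmxA CE' mul0mx.
have CgP' : C *m g1 *m P' = 0.
  have eE : E = invmx A *m E *m g1 by rewrite -mulmxA Eg mulmxA mulVmx // mul1mx.
  by rewrite eP' -scalemxAr mulmxA eE Jg sadjM mulmxA CE mul0mx scaler0.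
have CgC : C *m g1 = C *m g1 *m C' *m C.
  rewrite -[LHS]mulmx1 -sum1 !mulmxDr (mulmxA _ P) (mulmxA _ P') CgP CgP' !mul0mx !add0r.
  by rewrite !mulmxA.
split; last first.
  rewrite -[LHS]mul1mx -sum1 !mulmxDl -!mulmxA Eg E'g' CgC /Phi.
  by rewrite !mulmxA.
split.
- rewrite -row_free_unit /row_free eqn_leq rank_leq_row /=.
  apply: leq_trans (mxrankM_maxl _ C); rewrite -CgC mxrankMfree ?row_free_unit //.
  have : row_free C by apply/row_freeP; exists C'.
  by rewrite /row_free => /eqP->.
- move: CgC => /=; set X := C *m g1 *m C' => CgC.
  have -> : X *m (C *m s *m C^ad) *m X^ad = (X *m C) *m s *m (X *m C)^ad.
    by rewrite [(X *m C)^ad]sadjM !mulmxA.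
  by rewrite -CgC sadjM mulmxA -2!(mulmxA C) gJ.
by move=> u /=; rewrite -mulmxA -CgC mulmxA gQ.
Qed.

(** The difference of the inverses is [- A^-1 (A - A') A'^-1], so [E] and [E'] contribute equally;
    hence [kappa] is [2] for forms. *)
Lemma hyperbolic_iso_rank A A' X X' : A \in unitmx -> A' \in unitmx ->
  (\rank (Phi A X - Phi A' X')%R <= 2 * \rank (A - A')%R + \rank (X - X')%R)%N.
Proof.
move=> uA uA'; have -> : Phi A X - Phi A' X' = P *m (A - A') *m E +
    P' *m (invmx A - invmx A')^ad *m E' + C' *m (X - X') *m C.
  rewrite /Phi sadjB !mulmxBr !mulmxBl opprD addrACA; congr (_ + _).
  by rewrite opprD addrACA.
have rI : (\rank (invmx A - invmx A')%R <= \rank (A - A')%R)%N.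
  have -> : invmx A - invmx A' = - (invmx A *m (A - A') *m invmx A').
    by rewrite mulmxBr mulmxBl mulVmx // mul1mx mulmxK // opprB.
  by rewrite mxrank_opp; apply: leq_trans (mxrankM_maxl _ _) (mxrankM_maxr _ _).
have sub p q m l (B : 'M[F]_(p, q)) (B1 : 'M_(m, p)) (B2 : 'M_(q, l)) :
    (\rank (B1 *m B *m B2) <= \rank B)%N.
  by apply: leq_trans (mxrankM_maxl _ _) (mxrankM_maxr _ _).
apply: leq_trans (mxrank_add _ _) _; apply: leq_add; last exact: sub.
apply: leq_trans (mxrank_add _ _) _; rewrite mul2n -addnn; apply: leq_add; first exact: sub.
by apply: leq_trans (sub _ _ _ _ _ _ _) _; rewrite mxrank_sadj.
Qed.

End HyperbolicSplit.

End Forms.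

(** * Splitting blocks off isometries of a form *)

Section FormSplitting.
Variables (F : finFieldType) (sg : {rmorphism F -> F}) (et c : F).
Hypothesis sgK : involutive sg.
Hypothesis et2 : et * et = 1.
Hypothesis sg_et : sg et = et.
Hypothesis c_et : c = 0 \/ (forall x, sg x = x) /\ et = 1.
Hypothesis norm_iso : norm_isotropic sg.

Local Notation "A ^ad" := (sadj sg A) (at level 1, format "A ^ad").
Local Notation geometry := (geometry sg et c).

Lemma form_assemble M D n (s : geometry n) (g g1 : 'M[F]_n) d (al : 'M[F]_d.+1)
    (E E' : 'M[F]_(d.+1 * M, n)) :
  (0 < M)%N -> form_iso s g1 -> al \in unitmx ->
  isotropic s E -> isotropic s E' -> E *m s *m E'^ad = 1%:M ->
  E *m g1 = (al *t 1%:M) *m E -> E' = (al *t 1%:M)^ad *m E' *m g1 ->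
  (\rank (g - g1)%R * D <= 2 * (d.+1 * M))%N ->
  splits (@form_iso F sg et c) M D s g.
Proof.
move=> M0 ig1 ual isoE isoE' dualE Eg E'g rg.
pose P := s *m E'^ad; pose P' := et *: (s *m E^ad).
have EP : E *m P = 1%:M by rewrite mulmxA.
have EP' : E *m P' = 0 by rewrite -scalemxAr mulmxA isoE.1 scaler0.
have E'P : E' *m P = 0 by rewrite mulmxA isoE'.1.
have E'P' : E' *m P' = 1%:M.
  by rewrite -scalemxAr mulmxA (form_sym_pair sgK et2) dualE sadj1 scalerA et2 scale1r.
have EEPP : col_mx E E' *m row_mx P P' = 1%:M.
  by rewrite mul_col_row EP EP' E'P E'P' -scalar_mx_block.
have [b [C [C' [en CC' CPP EEC sum]]]] := complement_mx EEPP.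
move: CPP; rewrite mul_mx_row -row_mx0 => /eq_row_mx[CP CP'].
move: EEC; rewrite mul_col_mx -col_mx0 => /eq_col_mx[EC' E'C'].
rewrite mul_row_col in sum.
have en' : n = (2 * (d.+1 * M) + b)%N by rewrite mul2n -addnn.
have uA : al *t 1%:M \in (unitmx : {pred 'M_(d.+1 * M)}).
  by apply: tensmx_unit; rewrite ?unitmx1 // -lt0n.
have [ig' eg1] := hyperbolic_iso_restrict sgK et2 (erefl P) (erefl P') en' CC' CP CP' sum
  uA ig1 Eg E'g.
exists b, (restrict_form sgK et2 (erefl P) (erefl P') en' CP CP' sum), (C *m g1 *m C'),
  d, al, 2%N, (hyperbolic_iso sg E E' C C' P P'); split=> //.
- by rewrite -eg1.
- split; first exact: hyperbolic_iso1.
  by move=> A A' X X' uA1 uA1' _ _; apply: (hyperbolic_isoM sgK et2 isoE isoE' dualE).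
- by move=> A X uA1 iX; apply: (hyperbolic_iso_form sg_et isoE isoE' dualE CC' EC' E'C' uA1 iX).
by move=> A A' X X' uA1 uA1'; apply: hyperbolic_iso_rank.
Qed.

Section Strings.
Variables (n : nat) (s : geometry n.+1).

Lemma form_iso_pair (h : 'M[F]_n.+1) m p (x : 'M_(m, n.+1)) (z : 'M_(p, n.+1)) i j :
  form_iso s h -> (x *m h ^+ (i + j)) *m s *m (z *m h ^+ j)^ad = x *m h ^+ i *m s *m z^ad.
Proof.
move=> [_ hJ _]; elim: j => [|j IH]; first by rewrite addn0 expr0 mulmx1.
rewrite addnS !exprSr -[_ * h]/(_ *m h) -[h ^+ j * h]/(h ^+ j *m h) !mulmxA.
by rewrite (sadjM _ _ h) mulmxA -2!(mulmxA (x *m _)) hJ IH.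
Qed.

Lemma form_iso_quad_exp (h : 'M[F]_n.+1) (u : 'rV_n.+1) i :
  form_iso s h -> form_quad s (u *m h ^+ i) = form_quad s u.
Proof.
move=> [_ _ hQ]; elim: i => [|i IH]; first by rewrite expr0 mulmx1.
by rewrite exprSr -[_ * h]/(_ *m h) mulmxA hQ.
Qed.

(** For an isometry [h] the pairing of [x h^i] with [x h^j] depends on [i - j] only, so these
    conditions make the whole string isotropic. *)
Definition isotropic_strings (h : 'M[F]_n.+1) e m (x : 'M[F]_(m, n.+1)) :=
  (forall i, (i < e)%N -> x *m h ^+ i *m s *m x^ad = 0) /\
  (forall u, form_quad s (u *m x) = 0).

(** [totally_isotropic_subspace] is applied to the space of coefficients, with the pulled back forms
    [Jx i]; these need not be hermitian. *)
Lemma exists_isotropic_strings (h : 'M[F]_n.+1) e m t (x : 'M[F]_(t, n.+1)) :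
  (0 < e)%N -> (totally_isotropic_bound e m <= t)%N ->
  exists2 A : 'M[F]_(m, t), row_free A & isotropic_strings h e (A *m x).
Proof.
move=> e0 et_; pose Jx i := x *m h ^+ i *m s *m x^ad.
have [|u v||A [fA _ JA QA]] := @totally_isotropic_subspace _ _ sgK norm_iso t e Jx
    (fun u => form_quad s (u *m x)) c m _ 1%:M e0.
- by move=> a u; rewrite -scalemxAl form_quadZ.
- by rewrite mulmxDl form_quadD sadjM /Jx expr0 mulmx1 !mulmxA.
- by rewrite mxrank1.
exists A => //; split=> [i ie|u]; last by rewrite mulmxA QA.
by rewrite -(JA i ie) sadjM /Jx !mulmxA.
Qed.

Lemma isotropic_strings_mul h e m p (A : 'M[F]_(p, m)) (x : 'M[F]_(m, n.+1)) :
  isotropic_strings h e x -> isotropic_strings h e (A *m x).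
Proof.
move=> [x0 Qx]; split=> [i ie|u]; last by rewrite mulmxA Qx.
have -> : A *m x *m h ^+ i *m s *m (A *m x)^ad = A *m (x *m h ^+ i *m s *m x^ad) *m A^ad.
  by rewrite sadjM !mulmxA.
by rewrite x0 // mulmx0 mul0mx.
Qed.

Lemma isotropic_strings_pair h e m (x : 'M[F]_(m, n.+1)) i j : form_iso s h ->
  isotropic_strings h e x -> (i < e)%N -> (j < e)%N ->
  (x *m h ^+ i) *m s *m (x *m h ^+ j)^ad = 0.
Proof.
move=> ih [x0 _] ie je; have [ij|/ltnW ji] := leqP j i.
  by rewrite -(subnK ij) form_iso_pair // x0 // (leq_ltn_trans (leq_subr _ _)).
apply: (form_orthogonal_sym sgK et2).
by rewrite -(subnK ji) form_iso_pair // x0 // (leq_ltn_trans (leq_subr _ _)).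
Qed.

Lemma isotropic_strings_stack h e m (x : 'M[F]_(m, n.+1)) d (f : 'I_d -> nat) :
  form_iso s h -> isotropic_strings h e x -> (forall i, (f i < e)%N) ->
  isotropic s (stack (fun i => x *m h ^+ f i)).
Proof.
move=> ih ix fe; apply: isotropic_stack => [i j|i u].
  exact: isotropic_strings_pair ix _ _.
by rewrite mulmxA form_iso_quad_exp // ix.2.
Qed.

(* ta fixes the orthogonal of a and b, and exchanges x and x' whenever          *)
(* a = x - x' and x, x' pair to 1 and -1 with b, and to 0 with a.               *)
Lemma swap_form_iso m (a b : 'M[F]_(m, n.+1)) :
  isotropic s a -> isotropic s b -> a *m s *m b^ad = 2%:R%:M ->
  let ta := 1%:M - (s *m b^ad *m a + et *: (s *m a^ad *m b)) in
  form_iso s ta /\ ta *m ta = 1%:M.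
Proof.
move=> isoa isob ab; set X := s *m b^ad *m a + _ => ta.
have ba : b *m s *m a^ad = et *: 2%:R%:M.
  by rewrite (form_sym_pair sgK et2) ab sadj_scalar rmorph_nat.
have XX : X *m X = X + X.
  have e1 : s *m b^ad *m a *m X = (s *m b^ad *m a) *+ 2.
    rewrite /X mulmxDr -scalemxAr -!(mulmxA (s *m b^ad)) !(mulmxA a) ab isoa.1.
    by rewrite mul0mx mulmx0 scaler0 addr0 mul_scalar_mx scaler_nat !mulr2n mulmxDr.
  have e2 : s *m a^ad *m b *m X = (s *m a^ad *m b) *+ 2.
    rewrite /X mulmxDr -scalemxAr -!(mulmxA (s *m a^ad)) !(mulmxA b) ba isob.1.
    rewrite mul0mx mulmx0 add0r -scalemxAl mul_scalar_mx -scalemxAr scalerA et2 scale1r.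
    by rewrite scaler_nat !mulr2n mulmxDr.
  by rewrite {1}/X mulmxDl e1 -scalemxAl e2 -scalerMnr -mulrnDl mulr2n.
have tata : ta *m ta = 1%:M.
  by rewrite /ta mulmxBl mul1mx [X *m _]mulmxBr mulmx1 XX opprB addrK subrK.
split=> //; split.
- by case/mulmx1_unit: tata.
- have XJ : X *m s = s *m X^ad.
    have -> : X^ad = et *: (a^ad *m b *m s) + b^ad *m a *m s.
      rewrite /X sadjD sadjZ !sadjM !(sadjK sgK) form_sym sg_et -!scalemxAr.
      by rewrite scalerA et2 scale1r !mulmxA.
    by rewrite /X mulmxDl mulmxDr -scalemxAl -scalemxAr !mulmxA addrC.
  rewrite /ta sadjB sadj1 mulmxBl mul1mx mulmxBr mulmx1 mulmxBl -XJ.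
  rewrite -(mulmxA X) -XJ mulmxA XX mulmxDl.
  by rewrite opprB addrK subrK.
move=> u; pose p := u *m s *m b^ad; pose p' := et *: (u *m s *m a^ad).
have uX : u *m ta = u + (-1) *: (p *m a + p' *m b).
  rewrite /ta mulmxBr mulmx1 /X mulmxDr -scalemxAr !mulmxA scaleN1r /p /p'.
  by rewrite -scalemxAl.
have ep : u *m s *m b^ad = p by [].
have ep' : u *m s *m a^ad = et *: p' by rewrite /p' scalerA et2 scale1r.
clearbody p p'.
have isow : form_quad s (p *m a + p' *m b) = c * (2%:R *: (p *m p'^ad)) 0 0.
  rewrite form_quadD isoa.2 isob.2 !add0r sadjM !mulmxA -!(mulmxA p) ab.
  by rewrite mul_scalar_mx -scalemxAr.
rewrite uX form_quadD form_quadZ isow sadjZ sadjD !sadjM -scalemxAr mulmxDr !mulmxA ep ep'.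
(* Write [w = p a + p' b], so that [ta] sends [u] to [u - w]. When [c] may be nonzero, the value at
   [w] and [c] times the pairing of [u] with [w] are both [2 c p p'^ad], and they cancel. *)
rewrite rmorphN1; case: c_et => [c0|[sgE et1]].
  have cx x : c * x = 0 by rewrite c0 mul0r.
  by rewrite !cx mulr0 !addr0.
have etx (A : 'rV[F]_m) : et *: A = A by rewrite et1 scale1r.
have -> : et *: p' *m p^ad = (p *m p'^ad)^ad by rewrite etx sadjM (sadjK sgK).
by move: (p *m p'^ad) => A; rewrite !mxE sgE; ring.
Qed.

Lemma isotropic_sub m (x y : 'M[F]_(m, n.+1)) :
  isotropic s x -> isotropic s y -> x *m s *m y^ad = 0 -> isotropic s (x - y).
Proof.
move=> [x0 Qx] [y0 Qy] xy; split=> [|u].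
  rewrite sadjB !mulmxBl !mulmxBr x0 y0 xy (form_orthogonal_sym sgK et2 xy).
  by rewrite !subrr.
rewrite mulmxBr -scaleN1r form_quadD form_quadZ Qx Qy sadjZ sadjM -scalemxAr.
have -> : u *m x *m s *m (y^ad *m u^ad) = u *m (x *m s *m y^ad) *m u^ad by rewrite !mulmxA.
by rewrite xy mulmx0 mul0mx scaler0 mxE !mulr0 !addr0.
Qed.

End Strings.

Lemma form_inverse n (s : geometry n) g : form_iso s g ->
  g *m s = s *m (invmx g)^ad /\ form_iso s (invmx g).
Proof.
move=> [ug gJ gQ]; have adj : g *m s = s *m (invmx g)^ad.
  by rewrite -{2}gJ -mulmxA -sadjM mulVmx // sadj1 mulmx1.
split=> //; split; first by rewrite unitmx_inv.
  by rewrite -mulmxA -adj mulmxA mulVmx // mul1mx.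
by move=> u; rewrite -gQ mulmxKV.
Qed.

(** The isotropy bound is nested because isotropic combinations are taken twice: of the strings of
    [g], then of their duals. *)
Definition form_split_bound M D :=
  let L := (2 * D.+1).+1 in
  (3 ^ L * ((totally_isotropic_bound L (totally_isotropic_bound L M)).+1 * L + 12))%N.

Lemma form_splits M D n (s : geometry n) (g : 'M[F]_n) : (0 < M)%N ->
  (form_split_bound M D < n)%N -> form_iso s g ->
  splits (@form_iso F sg et c) M D.+1 s g.
Proof.
case: n s g => // n s g M0 large ig; have [adj ik] := form_inverse ig.
have ug := form_iso_unit ig; set k := invmx g in adj ik.
pose L := (2 * D.+1).+1; pose m1 := totally_isotropic_bound L M.
have [d [K [x0 [/andP[d0 dL] indx0]]]] := exists_string_family sgK adj (form_rank s) large.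
have [A1 fA1 ix1] := exists_isotropic_strings (m := m1) s g x0 (ltn0Sn _) (leqnn _).
have := indep_strings_mul fA1 indx0; move: ix1; set x1 := A1 *m x0 => ix1 indx1 alt.
(* Making the duals isotropic replaces [z1] by [A2 *m z1]. Multiplying [x1] by the adjoint of a
   right inverse [B] of [A2] restores the duality and keeps [x1] isotropic. *)
have duals (o : nat) : exists z x : 'M[F]_(M, n.+1),
    [/\ (z <= K)%MS, (x <= x0)%MS, isotropic_strings s g L x, isotropic_strings s k L z
      & forall i, (i < d)%N -> x *m g ^+ i *m s *m z^ad = (i == o)%:R%:M].
  have [z1 z1K xz] := exists_dual sgK o indx1.
  have [A2 fA2 iz] := exists_isotropic_strings (m := M) s k z1 (ltn0Sn _) (leqnn _).
  have /row_freeP[B A2B] := fA2.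
  exists (A2 *m z1), (B^ad *m x1); split=> //.
  - by rewrite mulmx_sub.
  - by rewrite /x1 mulmxA submxMl.
  - exact: isotropic_strings_mul.
  move=> i id; have -> : B^ad *m x1 *m g ^+ i *m s *m (A2 *m z1)^ad =
      B^ad *m (x1 *m g ^+ i *m s *m z1^ad) *m A2^ad by rewrite sadjM !mulmxA.
  rewrite xz // mul_mx_scalar -scalemxAl -sadjM A2B sadj1.
  by rewrite scalemx1.
case: alt => [[f [sf x0f Kf]]|edL].
  case: d d0 dL indx0 indx1 duals sf => // d _ dL _ _ duals sf.
  have [z [x [zK xx0 ix iz xz]]] := duals d.
  have xf : x *m horner_mx g f = 0.
    by have /submxP[B ->] := xx0; rewrite -mulmxA x0f mulmx0.
  have [al [B /= [ual EE' Eg E'k]]] := close_polynomial sgK adj M0 ug sf xf (Kf _ _ zK) xz.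
  move: EE' Eg E'k; set E := stack _; set E' := B *m _ => EE' Eg E'k.
  apply: (@form_assemble _ _ _ s g g d al E E') => //.
  - by apply: (isotropic_strings_stack ig ix) => i; apply: leq_trans dL.
  - apply: isotropic_mul; apply: (isotropic_strings_stack ik iz) => i.
    by apply: leq_ltn_trans (leq_subr _ _) dL.
  - by rewrite -E'k mulmxKV.
  - by rewrite subrr mxrank0.
subst d; have [z [y [_ _ iy iz yz]]] := duals D.+1.
pose a := cycle_left g D y; pose b := cycle_right k D z.
have small i : (i <= D.+1)%N -> (i < L)%N by rewrite /L; lia.
have iso_exp h m (x : 'M[F]_(m, n.+1)) i : form_iso s h -> isotropic_strings s h L x ->
    (i <= D.+1)%N -> isotropic s (x *m h ^+ i).
  move=> ih ix iD; split; first by apply: (isotropic_strings_pair ih ix); apply: small.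
  by move=> u; rewrite mulmxA form_iso_quad_exp // ix.2.
have isoa : isotropic s a.
  have := iso_exp _ _ _ 0%N ig iy isT; rewrite expr0 mulmx1 => isoy.
  apply: isotropic_sub => //; first exact: (iso_exp _ _ _ _ ig iy).
  have := isotropic_strings_pair ig iy (small _ (leq0n _)) (small _ (leqnn _)).
  by rewrite expr0 mulmx1.
have isob : isotropic s b.
  have := iso_exp _ _ _ 0%N ik iz isT; rewrite expr0 mulmx1 => isoz.
  apply: isotropic_sub => //; first exact: (iso_exp _ _ _ _ ik iz).
  have := isotropic_strings_pair ik iz (small _ (leqnn _)) (small _ (leq0n _)).
  by rewrite expr0 mulmx1.
have ab : a *m s *m b^ad = 2%:R%:M.
  rewrite {1}/a /cycle_left !mulmxBl.
  have := pair_cycle_right adj yz (leq0n _); rewrite expr0 !mulmx1 -/b => ->.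
  have := pair_cycle_right adj yz (leqnn _); rewrite -/b => ->.
  by rewrite !eqxx /= sub0r subr0 -raddfB opprK.
have [ita tata] := swap_form_iso isoa isob ab; set ta := 1%:M - _ in ita tata.
have aJ (i : nat) : (i <= D.+1)%N ->
    y *m g ^+ i *m ta = y *m g ^+ i - ((i == 0%N)%:R - (i == D.+1)%:R) *: a.
  move=> iD; rewrite mulmxBr mulmx1; congr (_ - _).
  have y0 : y *m g ^+ i *m s *m a^ad = 0.
    rewrite sadjB mulmxBr (isotropic_strings_pair ig iy) ?small // subr0.
    have := isotropic_strings_pair ig iy (small _ iD) (small _ (leq0n _)).
    by rewrite expr0 mulmx1.
  rewrite mulmxDr -scalemxAr !mulmxA y0 mul0mx scaler0 addr0.
  by rewrite (pair_cycle_right adj yz iD) mul_scalar_mx.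
have bJ (j : nat) : (j <= D)%N ->
    z *m k ^+ (D.+1 - j) *m ta = z *m k ^+ (D.+1 - j) - (j == 0%N)%:R *: b.
  move=> jD; rewrite mulmxBr mulmx1; congr (_ - _).
  have jD' : (D.+1 - j <= D.+1)%N by apply: leq_subr.
  have z0 : z *m k ^+ (D.+1 - j) *m s *m b^ad = 0.
    rewrite sadjB mulmxBr (isotropic_strings_pair ik iz) ?small // sub0r.
    have := isotropic_strings_pair ik iz (small _ jD') (small _ (leq0n _)).
    by rewrite expr0 mulmx1 => ->; rewrite oppr0.
  have az : z *m k ^+ (D.+1 - j) *m s *m a^ad = et *: (j == 0%N)%:R%:M.
    rewrite (form_sym_pair sgK et2) (pair_cycle_left adj yz (leqW jD)).
    by rewrite [j == D.+1]ltn_eqF ?ltnS // subr0 sadj_scalar rmorph_nat.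
  rewrite mulmxDr -scalemxAr !mulmxA z0 mul0mx add0r az -scalemxAl scalerA et2 scale1r.
  by rewrite mul_scalar_mx.
apply: (@form_assemble _ _ _ s g (g *m ta) D (cycle_mx F D)
   (stack (fun i : 'I_D.+1 => y *m g ^+ i))
   (stack (fun i : 'I_D.+1 => z *m k ^+ (D.+1 - i)))) => //.
- exact: form_isoM.
- exact: cycle_mx_unit.
- by apply: (isotropic_strings_stack ig iy) => i; apply: small; apply: ltnW.
- by apply: (isotropic_strings_stack ik iz) => i; apply: small; apply: leq_subr.
- exact: (cycle_dual adj yz).
- exact: (cycle_action_left aJ).
- by rewrite -(cycle_action_right sg bJ) !mulmxA mulmxKV // -mulmxA tata mulmx1.
rewrite [(D.+1 * M)%N]mulnC mulnA leq_mul2r /=.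
have -> : g - g *m ta = g *m (s *m b^ad *m a + et *: (s *m a^ad *m b)).
  by rewrite /ta mulmxBr mulmx1 opprB addrC subrK.
apply: leq_trans (mxrankM_maxr _ _) _; apply: leq_trans (mxrank_add _ _) _.
rewrite mul2n -addnn; apply: leq_add.
  by apply: leq_trans (mxrankM_maxr _ _) (rank_leq_row _).
by rewrite scalemxAr; apply: leq_trans (mxrankM_maxr _ _) (rank_leq_row _).
Qed.

End FormSplitting.

(** * Classical groups *)

Section Gram.
Variables (F : fieldType) (sg : {rmorphism F -> F}) (n : nat).
Implicit Types (u v : 'rV[F]_n).

Lemma mx_eq_form (A A' : 'M[F]_n) :
  (forall u v, (u *m A *m sadj sg v) 0 0 = (u *m A' *m sadj sg v) 0 0) -> A = A'.
Proof.
have ent (N : 'M[F]_n) i j : N i j =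
      ((delta_mx 0 i : 'rV_n) *m N *m sadj sg (delta_mx 0 j : 'rV_n)) 0 0.
  by rewrite /sadj trmx_delta map_delta_mx -rowE -colE !mxE.
by move=> AA'; apply/matrixP => i j; rewrite ent AA' -ent.
Qed.

Lemma semilinear_sum (h : F -> F) (f : 'rV[F]_n -> F) :
  (forall a u v, f (a *: u + v) = h a * f u + f v) -> f 0 = 0 ->
  forall u, f u = \sum_j h (u 0 j) * f (delta_mx 0 j).
Proof.
move=> fP f0 u; rewrite {1}[u]row_sum_delta.
by elim/big_rec2: _ => // j _ y _ <-; rewrite fP.
Qed.

Variable B : 'rV[F]_n -> 'rV[F]_n -> F.
Hypothesis Bl : forall v a u1 u2, B (a *: u1 + u2) v = a * B u1 v + B u2 v.
Hypothesis Br : forall u a v1 v2, B u (a *: v1 + v2) = sg a * B u v1 + B u v2.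

Lemma gramE u v : B u v = (u *m matrix_of_form B *m sadj sg v) 0 0.
Proof.
have B0l w : B 0 w = 0.
  by apply: (addIr (B 0 w)); have := Bl w 1 0 0; rewrite scaler0 addr0 mul1r add0r => <-.
have B0r w : B w 0 = 0.
  by apply: (addIr (B w 0)); have := Br w 1 0 0; rewrite scaler0 addr0 rmorph1 mul1r add0r => <-.
rewrite (semilinear_sum (h := id) (Bl v) (B0l v)) -mulmxA mxE; apply: eq_bigr => i _.
rewrite (semilinear_sum (Br _) (B0r _)) mxE; congr (_ * _); apply: eq_bigr => j _.
by rewrite !mxE mulrC.
Qed.

Lemma gram_isometry (g : 'M[F]_n) :
  (forall u v, B (u *m g) (v *m g) = B u v) <->
  g *m matrix_of_form B *m sadj sg g = matrix_of_form B.
Proof.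
have e u v : B (u *m g) (v *m g) =
    (u *m (g *m matrix_of_form B *m sadj sg g) *m sadj sg v) 0 0.
  by rewrite gramE sadjM !mulmxA.
split=> [gB|gJ u v]; last by rewrite e gJ gramE.
by apply: mx_eq_form => u v; rewrite -e gB gramE.
Qed.

Lemma gram_sym et : (forall u v, B u v = et * sg (B v u)) -> et * et = 1 ->
  sadj sg (matrix_of_form B) = et *: matrix_of_form B.
Proof.
move=> BC et2; apply/matrixP => i j; rewrite !mxE [in RHS]BC mulrA et2 mul1r.
by [].
Qed.

Lemma gram_rank_full : (forall u, (forall v, B u v = 0) -> u = 0) ->
  \rank (matrix_of_form B) = n.
Proof.
move=> nd; apply/eqP; rewrite -[_ == _]/(row_free _) -kermx_eq0 -submx0.
apply/row_subP => i; set u := row _ _.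
suff -> : u = 0 by apply: sub0mx.
apply: nd => v; rewrite gramE; have -> : u *m matrix_of_form B = 0.
  by apply/sub_kermxP; apply: row_sub.
by rewrite mul0mx mxE.
Qed.

End Gram.

Lemma nondegenerate_injective (F : fieldType) (n : nat) (eps : bool) (sg : {rmorphism F -> F})
    (B : {hermitian 'rV[F]_n for eps & sg}) :
  nondegenerate B -> forall u, (forall v, B u v = 0) -> u = 0.
Proof.
move=> /eqP nd u Bu; apply/eqP; rewrite -memv0 -nd.
by apply/mem_orthovP => v _; apply: Bu.
Qed.

Section WordImages.
Variables (k : nat) (F : finFieldType) (m : nat).

Lemma GLval_word_eval (g : 'I_k -> {'GL_m.+1[F]}) (w : free_group 'I_k) :
  GLval (word_eval g w) = mxword (fun i => GLval (g i)) (word w).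
Proof.
rewrite /word_eval; elim/last_ind: (word w) => [|s a IH]; first by rewrite big_nil.
rewrite big_rcons GL_MxE IH mxword_rcons; congr (_ *m _).
by rewrite /letter_eval /mxletter; case: a.2; rewrite ?GL_VxE.
Qed.

Lemma word_image_mxword (w : free_group 'I_k) (G : {set {'GL_m.+1[F]}})
    (h : 'I_k -> 'M[F]_m.+1) :
  (forall i, exists2 x, x \in G & GLval x = h i) ->
  exists2 y, y \in word_image w G & GLval y = mxword h (word w).
Proof.
move=> /(_ _)/cid2 hx; pose g := [ffun i => s2val (hx i)].
exists (word_eval g w).
  apply/imsetP; exists g => //; apply/ffun_onP => i; rewrite ffunE.
  exact: (s2valP (hx i)).
rewrite GLval_word_eval /mxword; elim/last_ind: (word w) => // s a IH.
rewrite !foldl_rcons IH /mxletter ffunE.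
by rewrite (s2valP' (hx a.1)).
Qed.

Lemma GL_of_unit (A : 'M[F]_m.+1) : A \in unitmx -> exists x : {'GL_m.+1[F]}, GLval x = A.
Proof. by move=> uA; exists (FinRing.unit _ uA). Qed.

End WordImages.

(** * Density in the classical groups *)

Section Density.
Variables (k : nat) (w : free_group 'I_k).
Variables (e M : nat).
Hypothesis M_gt0 : (0 < M)%N.
Hypothesis w_tensor : forall (F : fieldType) d (al : 'M[F]_d.+1), al \in unitmx ->
  exists2 A : 'I_k -> 'M[F]_(d.+1 * M), forall i, A i \in unitmx &
    (\rank (mxword A (word w) - al *t 1%:M)%R * (2 * e.+1) <= d.+1 * M)%N.

(** Then [D.+1] is [2 * e.+1], the precision that [splits_word_dense] asks of a single splitting. *)
Let D := (2 * e.+1).-1.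

Definition density_const := maxn (form_split_bound M D).+1
  (3 ^ (2 * D.+1).+1 * (M.+1 * (2 * D.+1).+1 + 12)).+1.

Lemma form_word_dense (F : finFieldType) (sg : {rmorphism F -> F}) (et c : F) m
    (s : geometry sg et c m.+1) (G : {set {'GL_m.+1[F]}}) :
  involutive sg -> et * et = 1 -> sg et = et ->
  (c = 0 \/ (forall x, sg x = x) /\ et = 1) -> norm_isotropic sg ->
  (forall x : {'GL_m.+1[F]}, x \in G <-> form_iso s (GLval x)) ->
  forall g, g \in G -> exists2 y, y \in word_image w G &
    (\rank (GLval g - GLval y)%R * e.+1 <= m.+1 + density_const * e.+1)%N.
Proof.
move=> sgK et2 sget c_et niso GP g /GP ig.
have [h ih rh] := splits_word_dense (@form_iso1 F sg et c) (@form_iso_unit F sg et c)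
  M_gt0 (@w_tensor F) (C := density_const)
  (fun n s g (large : (density_const <= n)%N) (ig : form_iso s g) =>
     form_splits sgK et2 sget c_et niso M_gt0 (leq_trans (leq_maxl _ _) large) ig) ig.
have [i|y yw ey] := @word_image_mxword k F m w G h.
  have [x ex] := GL_of_unit (form_iso_unit (ih i)).
  by exists x => //; apply/GP; rewrite ex.
by exists y => //; rewrite ey.
Qed.

Lemma GL_word_dense (F : finFieldType) m (g : {'GL_m.+1[F]}) :
  exists2 y, y \in word_image w [set: {'GL_m.+1[F]}] &
    (\rank (GLval g - GLval y)%R * e.+1 <= m.+1 + density_const * e.+1)%N.
Proof.
have [h ih rh] := splits_word_dense (fun n _ => unitmx1 F n) (fun n _ g ug => ug)
  M_gt0 (@w_tensor F) (C := density_const) (iso := @GL_iso F) (s := tt)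
  (fun n s g (large : (density_const <= n)%N) (ug : GL_iso s g) =>
     match s with tt => GL_splits M_gt0 (leq_trans (leq_maxr _ _) large) ug end)
  (GL_unit g).
have [i|y yw ey] := @word_image_mxword k F m w [set: {'GL_m.+1[F]}] h.
  by have [x ex] := GL_of_unit (ih i); exists x => //; rewrite inE.
by exists y => //; rewrite ey.
Qed.

Lemma form_isometries_word_dense (F : finFieldType) (sg : {rmorphism F -> F}) (eps : bool) m
    (B : {hermitian 'rV[F]_m.+1 for eps & sg}) :
  involutive sg -> norm_isotropic sg -> nondegenerate B ->
  forall g, g \in form_isometries B -> exists2 y, y \in word_image w (form_isometries B) &
    (\rank (GLval g - GLval y)%R * e.+1 <= m.+1 + density_const * e.+1)%N.
Proof.
move=> sgK niso nd; pose et : F := (-1) ^+ eps.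
have et2 : et * et = 1 by rewrite -expr2 sqrr_sign.
have sget : sg et = et by rewrite rmorph_sign.
have Bl v a u1 u2 : B (a *: u1 + u2) v = a * B u1 v + B u2 v by apply: linearPl.
have Br u a v1 v2 : B u (a *: v1 + v2) = sg a * B u v1 + B u v2 by apply: linearPr.
have BC u v : B u v = et * sg (B v u) by apply: hermC.
have rankB : (m.+1 <= \rank (matrix_of_form B) + 6)%N.
  by rewrite (gram_rank_full Bl Br (nondegenerate_injective nd)) leq_addr.
have quadD (u v : 'rV[F]_m.+1) :
    0 = 0 + 0 + 0 * (u *m matrix_of_form B *m sadj sg v) 0 0 :> F.
  by rewrite mul0r !addr0.
pose s := @Geometry F sg et 0 m.+1 (matrix_of_form B) (fun _ => 0) (gram_sym BC et2)
  rankB (fun a u => esym (mulr0 _)) quadD.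
apply: (@form_word_dense F sg et 0 m s) => // [|x]; first by left.
rewrite inE; split=> [/'forall_'forall_eqP xB|[_ xB _]].
  split=> //; last exact/(gram_isometry Bl Br).
  exact: (GL_unit x).
by apply/'forall_'forall_eqP; apply/(gram_isometry Bl Br).
Qed.

Lemma quadratic_isometries_word_dense (F : finFieldType) m (Q : 'rV[F]_m.+1 -> F) :
  quadratic_form Q -> nonsingular_quadratic Q ->
  forall g, g \in quadratic_isometries Q ->
  exists2 y, y \in word_image w (quadratic_isometries Q) &
    (\rank (GLval g - GLval y)%R * e.+1 <= m.+1 + density_const * e.+1)%N.
Proof.
move=> [QZ [Pl Pr]] ns; pose sg := GRing.RMorphism.clone F F idfun _.
have sgK : involutive sg by [].
have niso : norm_isotropic sg by apply: norm_isotropic_id.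
have Bl v a u1 u2 : polar Q (a *: u1 + u2) v = a * polar Q u1 v + polar Q u2 v by apply: Pl.
have Br u a v1 v2 : polar Q u (a *: v1 + v2) = sg a * polar Q u v1 + polar Q u v2.
  exact: Pr.
have BC u v : polar Q u v = 1 * sg (polar Q v u).
  rewrite mul1r -[RHS]/(polar Q v u) /polar (addrC v) -!addrA.
  by rewrite (addrC (- Q u)).
pose J := matrix_of_form (polar Q).
have quadZ a u : Q (a *: u) = a * sg a * Q u by rewrite QZ expr2.
have quadD u v : Q (u + v) = Q u + Q v + 1 * (u *m J *m sadj sg v) 0 0.
  by rewrite mul1r -(gramE Bl Br) /polar; ring.
(* A radical of dimension [7] would contain a nonzero zero of [Q], against nonsingularity; the
   argument is the same in all characteristics. *)
have rankJ : (m.+1 <= \rank J + 6)%N.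
  rewrite leqNgt; apply/negP => rJ.
  have qQ : quadratic_map sg Q.
    split=> //; exists J, 0 => u v.
    by rewrite quadD mul1r mulmx0 mul0mx [X in _ = _ + X]mxE addr0.
  have [|v [vK v0 Qv]] := isotropic_vector sgK niso (S := kermx J) qQ.
    by rewrite mxrank_ker ltn_subRL.
  case/negP: v0; apply/eqP; apply: ns Qv => u.
  by rewrite (gramE Bl Br) (sub_kermxP vK) mul0mx mxE.
pose s := @Geometry F sg 1 1 m.+1 J Q (gram_sym BC (mulr1 1)) rankJ quadZ quadD.
apply: (@form_word_dense F sg 1 1 m s) => // [||x]; [exact: mulr1|by right|].
rewrite inE; split=> [/'forall_eqP xQ|[_ _ xQ]]; last exact/'forall_eqP.
split=> //; first exact: (GL_unit x).
by apply/(gram_isometry Bl Br) => u v; rewrite /polar -mulmxDl !xQ.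
Qed.

Lemma classical_word_dense (F : finFieldType) m q (G : {group {'GL_m.+1[F]}}) :
  classical_group q G -> forall g, g \in G ->
  exists2 y, y \in word_image w G &
    (\rank (GLval g - GLval y)%R * e.+1 <= m.+1 + density_const * e.+1)%N.
Proof.
case=> [_ _ g _|n' B _ _ _ _ nd|n' Q _ _ _ qQ ns|n' Q _ _ _ qQ ns _|n' Q _ _ _ qQ ns _|
  conj B cF conjE _ nd].
- exact: GL_word_dense.
- pose sg := GRing.RMorphism.clone F F idfun _.
  apply: (@form_isometries_word_dense F sg true m B) => //.
  exact: norm_isotropic_id.
- exact: quadratic_isometries_word_dense.
- exact: quadratic_isometries_word_dense.
- exact: quadratic_isometries_word_dense.
apply: form_isometries_word_dense nd.
  exact: frobenius_involutive cF conjE.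
exact: norm_isotropic_frobenius cF conjE.
Qed.

End Density.


Theorem theorem2 (R : realType) (k : nat) (k_ge1 : (1 <= k)%N)
    (w : free_group 'I_k) (w_neq1 : w <> 1%g) (eps : R) (eps_gt0 : (0 < eps)%R) :
  exists N : nat,
    forall (q m : nat) (F : finFieldType) (G : {group {'GL_m.+1[F]}}),
      classical_group q G -> (N <= m.+1)%N ->
      eps_dense (@rank_dist F m R) [set` G]%classic [set` word_image w G]%classic eps.
Proof.
have w_nil : word w != [::].
  by apply/eqP => w0; apply: w_neq1; apply: val_inj.
(* [e.+1] exceeds [2 / eps]. The choice of [N] bounds the constant term [density_const e M * e.+1]
   by [m.+1], so the rank times [e.+1] is at most [2 * m.+1]. *)
pose e := Num.truncn (2 / eps).
have eE : 2 <= eps * e.+1%:R.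
  by rewrite -ler_pdivrMl // mulrC ltW // truncnS_gt.
have [M M0 wM] := word_tensor (2 * e.+1) (valP w) w_nil.
exists (density_const e M * e.+1)%N => q m F G clG large g Gg.
have [y yw rgy] := classical_word_dense M0 wM clG Gg.
apply: (@le_trans _ _ (rank_dist R g y)).
  apply: ge_inf; last by exists y.
  by exists 0 => _ [z _ <-]; rewrite /rank_dist divr_ge0.
rewrite /rank_dist ler_pdivrMr ?ltr0n //.
rewrite -(ler_pM2r (_ : 0 < e.+1%:R)) ?ltr0n // -natrM.
apply: le_trans (_ : (2 * m.+1)%:R <= _).
  by rewrite ler_nat; apply: leq_trans rgy _; rewrite mul2n -addnn leq_add2l.
by rewrite natrM mulrAC ler_wpM2r.
Qed.
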